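(* Let $m\ge1$ and let $T\subseteq[m-1]$ be a set of coranks of $\Omega_m$. Let $b_m(T)$ be the multiplicity of the trivial representation of $\mathfrak S_m$ in the top homology of the corank-selected subposet $\Omega_m(T)$. (a) If $m-1\notin T$, then $b_m(T)=\#\{\sigma\in\mathfrak S_{m-1}:\operatorname{Des}\sigma=T\}$; hence $b_m(T)\ge1$ in this case. (b) If $m-1\in T$, then $b_m(T)=0$.
   Context: An ordered set partition of $[m]$ is a sequence of nonempty disjoint blocks with union $[m]$. These are ordered by merging adjacent blocks in place (covers $(B_1,\ldots,B_k)\lessdot(B_1,\ldots,B_i\cup B_{i+1},\ldots,B_k)$, extended transitively); $\Omega_m$ is this poset with a minimum $\hat0$ adjoined; it is graded of rank $m$ with maximum $([m])$, and $\operatorname{crk}x=m-\operatorname{rk}x$. $\mathfrak S_m$ acts by permuting block entries. $\Omega_m(T)=\{x:\operatorname{crk}x\in T\}\cup\{\hat0,\hat1\}$; its top homology is the top reduced rational homology of the order complex of its proper part (trivial module when $T=\emptyset$). $\operatorname{Des}\sigma=\{j:\sigma(j)>\sigma(j+1)\}$. *)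

(* Defs.v *)
From HB Require Import structures.
From mathcomp Require Import all_boot all_order all_fingroup all_algebra.
From mathcomp Require Import all_solvable all_field all_character.
From mathcomp Require Import finmap.

Set Implicit Arguments.
Unset Strict Implicit.
Unset Printing Implicit Defensive.

Import Order.TTheory GRing.Theory.

(* The ground set [m] is 'I_m, i.e. {0, .., m-1}. *)

Section OrderedSetPartitions.

Variable m : nat.

Definition is_osp (s : seq {set 'I_m}) : bool :=
  [&& set0 \notin s, \bigcup_(B <- s) B == [set: 'I_m]
    & pairwise (fun A B : {set 'I_m} => [disjoint A & B]) s].

(* Nonempty disjoint blocks number at most m, so the length bound of m.-bseq
   excludes nothing; it only makes the type finite. *)
Record osp := Osp {osp_blocks :> m.-bseq {set 'I_m}; _ : is_osp osp_blocks}.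

HB.instance Definition _ := [isSub for osp_blocks].
HB.instance Definition _ := [Finite of osp by <:].

Definition osp_cover : rel osp := fun x y =>
  [exists i : 'I_m, (i.+1 < size x) &&
    (y == take i x ++ (nth set0 x i :|: nth set0 x i.+1) :: drop i.+2 x
       :> seq {set 'I_m})].

Definition osp_le : rel osp := connect osp_cover.

Lemma osp_cover_size x y : osp_cover x y -> size y < size x.
Proof.
case/existsP=> i /andP[lt_i /eqP->].
rewrite size_cat /= size_takel ?size_drop; last by rewrite ltnW // ltnW.
by rewrite -(subnKC lt_i) addKn !addSn addnS.
Qed.

Lemma osp_le_size x y : osp_le x y -> x = y \/ size y < size x.
Proof.
case/connectP=> p; elim: p x => [|z p IHp] x /=; first by left.
case/andP=> /osp_cover_size lt_zx /IHp{}IHp /IHp[<-|lt_yz]; right=> //.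
exact: ltn_trans lt_yz lt_zx.
Qed.

Lemma osp_le_anti : antisymmetric osp_le.
Proof.
move=> x y /andP[/osp_le_size[//|lt_yx] /osp_le_size[//|lt_xy]].
by have := ltn_trans lt_yx lt_xy; rewrite ltnn.
Qed.

Lemma osp_size_le (s : seq {set 'I_m}) : is_osp s -> size s <= m.
Proof.
case/and3P=> s0 /eqP sU sD.
suff: size s <= #|\bigcup_(B <- s) B| by rewrite sU cardsT card_ord.
elim: s s0 sD {sU} => [|A s IHs] //=; rewrite inE eq_sym => /norP[A0 s0].
case/andP=> /allP sA sD; rewrite big_cons cardsU.
have ->: A :&: \bigcup_(B <- s) B = set0.
  apply/eqP; rewrite setI_eq0; rewrite disjoint_sym big_seq.
  elim/big_rec: _ => [|B C /sA dAB dC]; first by rewrite disjoints_subset sub0set.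
  by rewrite disjoints_subset subUset -!disjoints_subset dC andbT disjoint_sym.
by rewrite cards0 subn0 -add1n leq_add ?card_gt0 ?IHs.
Qed.

Lemma is_osp_merge (s1 s2 : seq {set 'I_m}) A B :
  is_osp (s1 ++ A :: B :: s2) -> is_osp (s1 ++ (A :|: B) :: s2).
Proof.
case/and3P=> s0 sU sD; apply/and3P; split.
- move: s0; rewrite !mem_cat !inE !negb_or => /and4P[-> A0 _ ->].
  by rewrite andbT /= eq_sym setU_eq0 negb_and eq_sym A0.
- by move: sU; rewrite !big_cat /= !big_cons !setUA.
- move: sD; rewrite !pairwise_cat /= !allrel_consr.
  case/and3P=> /and3P[/allP s1A /allP s1B ->] -> /and3P[/andP[_ /allP As2]].
  move=> /allP Bs2 ->; rewrite !andbT /=; apply/andP; split; apply/allP=> C sC.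
    rewrite disjoint_sym disjoints_subset subUset -!disjoints_subset.
    by rewrite -!(disjoint_sym C) s1A ?s1B.
  by rewrite disjoints_subset subUset -!disjoints_subset As2 ?Bs2.
Qed.

(* The one-block partition ([m]); for m = 0 it is the empty sequence. *)
Definition osp_top_seq : seq {set 'I_m} := nseq (0 < m) setT.

Lemma osp_top_subproof : is_osp osp_top_seq.
Proof.
rewrite /is_osp /osp_top_seq; case: posnP => [m0|m_gt0] /=.
  rewrite big_nil andbT; apply/eqP/setP=> i.
  by have:= ltn_ord i; rewrite {2}m0.
rewrite inE big_seq1 eqxx !andbT; apply/eqP=> /setP/(_ (Ordinal m_gt0)).
by rewrite !inE.
Qed.

Definition osp_top : osp :=
  @Osp (Bseq (osp_size_le osp_top_subproof)) osp_top_subproof.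

Lemma osp_le_top x : osp_le x osp_top.
Proof.
have [n] := ubnP (size x); elim: n x => // n IHn [x xP] /= lt_xn.
case def_x: (x : seq _) => [|A [|B s]].
- suff ->: Osp xP = osp_top by apply: connect0.
  apply/val_inj/val_inj; rewrite /= /osp_top_seq def_x.
  move: xP; rewrite /is_osp def_x big_nil => /and3P[_ /eqP/setP U _].
  by case: posnP => // m_gt0; have:= U (Ordinal m_gt0); rewrite !inE.
- suff ->: Osp xP = osp_top by apply: connect0.
  apply/val_inj/val_inj; rewrite /= /osp_top_seq def_x.
  move: xP; rewrite /is_osp def_x big_seq1 inE => /and3P[A0 /eqP defA _].
  case: posnP => [m0|_] /=; last by rewrite defA.
  by move: A0; rewrite eq_sym => /set0Pn[i _]; have:= ltn_ord i; rewrite {2}m0.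
have yP: is_osp ((A :|: B) :: s).
  by apply: (@is_osp_merge [::]); rewrite /= -def_x.
pose y := @Osp (Bseq (osp_size_le yP)) yP.
have m_gt0: 0 < m by rewrite (leq_trans _ (size_bseq x)) // def_x.
have xy: osp_cover (Osp xP) y.
  by apply/existsP; exists (Ordinal m_gt0); rewrite /= def_x /= drop0 eqxx.
apply: connect_trans (connect1 xy) (IHn y _).
by apply: leq_trans (osp_cover_size xy) _; rewrite -ltnS.
Qed.

Definition osp_act_seq (s : seq {set 'I_m}) (g : 'S_m) : seq {set 'I_m} :=
  [seq g @: B | B : {set 'I_m} <- s].

Lemma osp_act_subproof (x : osp) (g : 'S_m) : is_osp (osp_act_seq x g).
Proof.
case: x => x /= /and3P[x0 /eqP xU xD]; apply/and3P; split.
- apply/mapP=> -[B xB /esym/eqP]; rewrite imset_eq0 => /eqP B0.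
  by rewrite B0 in xB; case/negP: x0.
- rewrite big_map eqEsubset subsetT; apply/subsetP=> i _.
  have: (g^-1)%g i \in \bigcup_(B <- x) B by rewrite xU.
  elim: (x : seq _) => [|B s IHs]; first by rewrite !big_nil inE.
  rewrite !big_cons !inE => /orP[Bi|/IHs->]; last by rewrite orbT.
  by rewrite -{1}(permKV g i) imset_f.
- rewrite pairwise_map; apply: sub_pairwise xD => A B /=.
  by rewrite imset_disjoint //; apply: perm_inj.
Qed.

Definition osp_act (x : osp) (g : 'S_m) : osp :=
  @Osp (Bseq (osp_size_le (osp_act_subproof x g))) (osp_act_subproof x g).

Lemma osp_act1 x : osp_act x 1%g = x.
Proof.
apply/val_inj/val_inj => /=; rewrite -[RHS]map_id; apply: eq_map => B /=.
by rewrite -[RHS]imset_id; apply: eq_imset => i; rewrite perm1.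
Qed.

Lemma osp_actM x g h : osp_act x (g * h)%g = osp_act (osp_act x g) h.
Proof.
apply/val_inj/val_inj => /=; rewrite /osp_act_seq -map_comp; apply: eq_map => B.
by rewrite /= -imset_comp; apply: eq_imset => i; rewrite /= permM.
Qed.

Lemma osp_act_cover g x y : osp_cover x y -> osp_cover (osp_act x g) (osp_act y g).
Proof.
case/existsP=> i /andP[lt_i /eqP def_y]; apply/existsP; exists i.
rewrite /= /osp_act_seq size_map lt_i /= def_y map_cat /= map_take map_drop.
by rewrite !(nth_map set0) ?imsetU // ltnW.
Qed.

Lemma osp_act_le g x y : osp_le x y -> osp_le (osp_act x g) (osp_act y g).
Proof.
case/connectP=> p; elim: p x => [|z p IHp] x /= => [_ ->|].
  exact: connect0.
case/andP=> /(osp_act_cover g) xz zp /(IHp _ zp).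
exact: connect_trans (connect1 xz).
Qed.

End OrderedSetPartitions.

(* None is the adjoined minimum. *)
Definition Omega (m : nat) : Type := option (osp m).

Fact Omega_display : Order.disp_t. Proof. exact: Order.Disp tt tt. Qed.

Section Omega.

Variable m : nat.

HB.instance Definition _ := Finite.on (Omega m).

Definition Omega_le : rel (Omega m) := fun x y =>
  match x, y with
  | None, _ => true
  | Some _, None => false
  | Some x, Some y => osp_le x y
  end.

Lemma Omega_le_refl : reflexive Omega_le.
Proof. by case=> //= x; apply: connect0. Qed.

Lemma Omega_le_anti : antisymmetric Omega_le.
Proof. by case=> [x|] [y|] //= /osp_le_anti->. Qed.

Lemma Omega_le_trans : transitive Omega_le.
Proof. by case=> [x|] [y|] [z|] //=; apply: connect_trans. Qed.

HB.instance Definition _ := Order.Le_isPOrder.Build Omega_display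
  (Omega m) Omega_le_refl Omega_le_anti Omega_le_trans.

Lemma Omega_le0x (x : Omega m) : ((None : Omega m) <= x)%O.
Proof. by []. Qed.

Lemma Omega_lex1 (x : Omega m) : (x <= (Some (osp_top m) : Omega m))%O.
Proof. by case: x => // x; apply: osp_le_top. Qed.

HB.instance Definition _ := Order.hasBottom.Build Omega_display
  (Omega m) Omega_le0x.
HB.instance Definition _ := Order.hasTop.Build Omega_display
  (Omega m) Omega_lex1.

Definition Omega_act (x : Omega m) (g : 'S_m) : Omega m :=
  omap (fun y => osp_act y g) x.

Lemma Omega_act1 : Omega_act^~ 1%g =1 id.
Proof. by case=> //= x; rewrite osp_act1. Qed.

Lemma Omega_actM (x : Omega m) g h :
  Omega_act x (g * h)%g = Omega_act (Omega_act x g) h.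
Proof. by case: x => //= x; rewrite osp_actM. Qed.

Definition Omega_action : {action 'S_m &-> Omega m} :=
  TotalAction Omega_act1 Omega_actM.

Lemma Omega_act_mono (g : 'S_m) :
  {mono (Omega_action^~ g) : x y / (x <= y)%O}.
Proof.
have homo h: {homo (Omega_action^~ h) : x y / (x <= y)%O}.
  by case=> [x|] [y|] //=; apply: osp_act_le.
move=> x y; apply/idP/idP => [/(homo g^-1%g)|/homo //].
by rewrite !actK.
Qed.

End Omega.

Section ChainsAndRank.

Context {d : Order.disp_t} {P : finPOrderType d}.

Definition is_chain (C : {set P}) : bool :=
  [forall x in C, forall y in C, (x >=< y)%O].

(* Length of a longest chain from below up to x: a chain with k elements
   strictly below x yields a chain of length k ending at x. *)
Definition rk (x : P) : nat :=
  \max_(C : {set P} | is_chain C && [forall y in C, (y < x)%O]) #|C|.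

(* The order complex of Q; its faces are indexed by cardinality, so faces Q k
   is the set of (k - 1)-dimensional faces, and faces Q 0 = [set set0]. *)
Definition faces (Q : {set P}) (k : nat) : {set {set P}} :=
  [set C : {set P} | [&& C \subset Q, is_chain C & #|C| == k]].

Definition max_face_card (Q : {set P}) : nat :=
  \max_(C : {set P} | (C \subset Q) && is_chain C) #|C|.

End ChainsAndRank.

Section EquivariantHomology.

Local Open Scope ring_scope.

Variables (d : Order.disp_t) (P : finPOrderType d) (gT : finGroupType).
Variables (to : {action gT &-> P}) (Q : {set P}).

Definition face (k : nat) (i : 'I_#|faces Q k|) : {set P} := enum_val i.

Lemma face_inj k : injective (@face k).
Proof. exact: enum_val_inj. Qed.

(* Augmented simplicial boundary, acting on row vectors on the right:
   x_0 < .. < x_(k-1) is sent to \sum_i (-1)^i [x_0, .., ^x_i, .., x_(k-1)].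
   For k = 0 the sum is empty and the boundary is zero. *)
Definition boundary (k : nat) : 'M[rat]_(#|faces Q k|, #|faces Q k.-1|) :=
  \matrix_(i, j) \sum_(x in face i | face j == face i :\ x)
     (-1) ^+ #|[set y in face i | (y < x)%O]|.

(* An order automorphism preserves the ordering of the vertices of a chain, so
   the action on oriented simplices involves no sign. *)
Definition chain_mx (k : nat) (g : gT) : 'M[rat]_#|faces Q k| :=
  \matrix_(i, j) (face j == to^*%act (face i) g)%:R.

Hypothesis to_mono : forall g, {mono (to^~ g) : x y / (x <= y)%O}.
Hypothesis to_stable : forall g x, x \in Q -> to x g \in Q.

Lemma faces_act k g C : C \in faces Q k -> to^*%act C g \in faces Q k.
Proof.
rewrite !inE => /and3P[/subsetP CQ /forall_inP Cch /eqP Ck].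
rewrite card_setact Ck eqxx andbT; apply/andP; split.
  by apply/subsetP=> _ /imsetP[x Cx ->]; rewrite to_stable ?CQ.
apply/forall_inP=> _ /imsetP[x Cx ->]; apply/forall_inP=> _ /imsetP[y Cy ->].
by rewrite /Order.comparable !to_mono; have/forall_inP/(_ y Cy) := Cch x Cx.
Qed.

Lemma chain_mx_mul k g n (A : 'M[rat]_(#|faces Q k|, n)) i j i' :
    face i' = to^*%act (face i) g ->
  (chain_mx k g *m A) i j = A i' j.
Proof.
move=> def_i'; rewrite mxE (bigD1 i') //= mxE def_i' eqxx mul1r.
rewrite big1 ?addr0 // => i1 ne_i1; rewrite mxE -def_i'.
by rewrite (inj_eq (@face_inj _)) (negPf ne_i1) mul0r.
Qed.

Lemma faces_act_ex k g (i : 'I_#|faces Q k|) :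
  {i' : 'I_#|faces Q k| | face i' = to^*%act (face i) g}.
Proof.
have h := faces_act g (enum_valP i).
by exists (enum_rank_in h (to^*%act (face i) g)); rewrite /face enum_rankK_in.
Qed.

Lemma chain_mx_repr k : mx_repr [set: gT] (chain_mx k).
Proof.
split=> [|g h _ _]; apply/matrixP=> i j.
  by rewrite !mxE act1 eq_sym (inj_eq (@face_inj _)).
have [i' def_i'] := faces_act_ex g i.
by rewrite (chain_mx_mul _ _ def_i') !mxE def_i' -actM.
Qed.

Canonical chain_repr k := MxRepresentation (chain_mx_repr k).

Lemma boundary_equivariant k g :
  chain_mx k g *m boundary k = boundary k *m chain_mx k.-1 g.
Proof.
apply/matrixP=> i j; have [i' def_i'] := faces_act_ex g i.
have [j' def_j'] := faces_act_ex g^-1%g j.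
have def_j: face j = to^*%act (face j') g by rewrite def_j' actKV.
have ->: (boundary k *m chain_mx k.-1 g) i j = boundary k i j'.
  rewrite mxE (bigD1 j') //= [chain_mx _ _ _ _]mxE def_j eqxx mulr1.
  rewrite big1 ?addr0 // => j1 ne_j1; rewrite [chain_mx _ _ _ _]mxE.
  rewrite def_j (inj_eq (act_inj _ g)) (inj_eq (@face_inj _)) eq_sym.
  by rewrite (negPf ne_j1) mulr0.
rewrite (chain_mx_mul _ _ def_i') !mxE def_i' def_j.
rewrite (reindex_inj (act_inj to g)) /=.
have imE (C : {set P}) x : (to x g \in to^*%act C g) = (x \in C).
  by apply: (mem_imset (f := to^~ g)); apply: act_inj.
apply: eq_big => x.
  rewrite imE; congr (_ && _); rewrite -[RHS](inj_eq (act_inj to^* g)).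
  congr (_ == _); apply/setP=> y; rewrite -[y](actKV to g) !(inE, imE).
  by rewrite (inj_eq (act_inj to g)).
move=> _; congr (_ ^+ _); rewrite -[RHS](card_setact to _ g).
congr #|pred_of_set _|.
apply/setP=> y; rewrite -[y](actKV to g) imE !inE imE.
by rewrite !lt_neqAle to_mono (inj_eq (act_inj to g)).
Qed.

Lemma cycles_module k : mxmodule (chain_repr k) (kermx (boundary k)).
Proof.
apply/mxmoduleP=> g _; apply/sub_kermxP.
by rewrite -mulmxA boundary_equivariant mulmxA mulmx_ker mul0mx.
Qed.

Lemma boundaries_module k : mxmodule (chain_repr k) <<boundary k.+1>>%MS.
Proof.
rewrite (eqmx_module _ (genmxE _)); apply/mxmoduleP=> g _.
by rewrite -(boundary_equivariant k.+1 g) submxMl.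
Qed.

(* Reduced rational homology of the order complex of Q in degree k - 1, i.e.
   ker (boundary k) / im (boundary k.+1), as a representation of gT. *)
Definition homology_repr (k : nat) :=
  section_repr (boundaries_module k) (cycles_module k).

Definition top_homology_repr := homology_repr (max_face_card Q).

End EquivariantHomology.

(* Multiplicity of the trivial representation in a rational representation,
   as the character inner product after extending scalars to algC. *)
Definition trivial_mult (gT : finGroupType) (G : {group gT}) (n : nat)
    (rG : mx_representation rat G n) : algC :=
  ('[cfRepr (map_repr (ratr : {rmorphism rat -> algC}) rG), 1]_G)%R.

Section CorankSelection.

Variables (m : nat) (T : {fset nat}).

Definition crk (x : Omega m) : nat := m - rk x.

Definition Omega_sel : {set Omega m} :=
  [set x | crk x \in T] :|: [set \bot%O; \top%O].

Definition Omega_sel_proper : {set Omega m} :=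
  Omega_sel :\: [set \bot%O; \top%O].

Lemma rk_act g (x : Omega m) : rk (Omega_action m x g) = rk x.
Proof.
suff le_rk h y : rk y <= rk (Omega_action m y h).
  by apply/eqP; rewrite eqn_leq le_rk andbT -{2}(actK (Omega_action m) g x).
apply/bigmax_leqP=> C /andP[/forall_inP Cch /forall_inP Cy].
rewrite -(card_setact (Omega_action m) C h).
rewrite /rk; apply: (leq_bigmax_cond (F := fun C : {set Omega m} => #|C|)).
apply/andP; split.
  apply/forall_inP=> _ /imsetP[u Cu ->]; apply/forall_inP=> _ /imsetP[v Cv ->].
  rewrite /Order.comparable !Omega_act_mono.
  by have/forall_inP/(_ v Cv) := Cch u Cu.
apply/forall_inP=> _ /imsetP[u Cu ->].
by rewrite lt_neqAle Omega_act_mono (inj_eq (act_inj _ h)) -lt_neqAle Cy.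
Qed.

Lemma Omega_sel_proper_stable g (x : Omega m) :
  x \in Omega_sel_proper -> Omega_action m x g \in Omega_sel_proper.
Proof.
have fix_bot : Omega_action m \bot%O g = \bot%O by [].
have fix_top : Omega_action m \top%O g = \top%O.
  apply/eqP; rewrite eq_le lex1 /=.
  have := Omega_act_mono g (Omega_action m \top%O g^-1%g) \top%O.
  by rewrite lex1 actKV.
have act_eq := inj_eq (act_inj (Omega_action m) g) x.
have := (act_eq \bot%O, act_eq \top%O); rewrite fix_bot fix_top => actE.
by rewrite !inE /crk rk_act !actE.
Qed.

Definition trivial_mult_top : algC :=
  trivial_mult
    (top_homology_repr (@Omega_act_mono m) Omega_sel_proper_stable).

End CorankSelection.

(* The letter j of {1, .., n} is the element j - 1 of 'I_n, so that j is a
   descent when s maps the ordinal j - 1 above the ordinal j. *)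
Definition Des (n : nat) (s : 'S_n) : {fset nat} :=
  [fset j in iota 1 n.-1
    | [exists i : 'I_n, exists i' : 'I_n,
        [&& i.+1 == j, i' == j :> nat & s i' < s i]]]%fset.

(* Main.v *)
Require Import Defs.
From HB Require Import structures.
From mathcomp Require Import all_boot all_order all_fingroup all_algebra.
From mathcomp Require Import all_solvable all_field all_character.
From mathcomp Require Import finmap zify.

(** The top homology is the kernel of the top boundary map, so the multiplicity
    of the trivial representation is rank(P) - rank(P d), where P averages over
    the group and d is the boundary.  Up to the action, an ordered set partition
    of [m] is its set of cuts, a subset of [m-1], and coarsening removes cuts;
    hence the orbits of chains of coranks T are the flags of subsets of [m-1]
    with cardinalities T, and P d has the rank of the span of the vectors
    [above G] (the indicator of the flags refining G), for G missing one
    cardinality.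

    For a member A of G, summing [above] over all ways to replace A by a set of
    the same cardinality gives [above (G :\ A)].  When A is not a descent of G
    it has the least element sum among its replacements, so this relation
    rewrites [above G] in terms of shorter or heavier chains; the [above G] with
    every member a descent therefore span.  Such G are the flags of a permutation
    at its own descent set, and a permutation with descents inside T is
    determined by its flag of type T, so the spanning sets are forced to be bases
    and the corank is the number of permutations with descent set T. *)

Set Implicit Arguments.
Unset Strict Implicit.
Unset Printing Implicit Defensive.

Import Order.TTheory GRing.Theory Num.Theory.

(** * Averaging over the group *)

Section Averaging.

Local Open Scope ring_scope.

Variables (gT : finGroupType) (G : {group gT}).

Definition avg_mx n (rG : mx_representation rat G n) : 'M[rat]_n :=
  #|G|%:R^-1 *: \sum_(g in G) rG g.

Lemma natrG_neq0 : #|G|%:R != 0 :> rat.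
Proof. by rewrite pnatr_eq0 -lt0n cardG_gt0. Qed.

Lemma avg_mx_fix n (rG : mx_representation rat G n) k (A : 'M_(k, n)) :
  (forall g, g \in G -> A *m rG g = A) -> A *m avg_mx rG = A.
Proof.
move=> fixA; rewrite -scalemxAr mulmx_sumr (eq_bigr (fun=> A)) //.
by rewrite sumr_const -scaler_nat scalerA mulVf ?scale1r ?natrG_neq0.
Qed.

Lemma avg_mxJ n (rG : mx_representation rat G n) h :
  h \in G -> avg_mx rG *m rG h = avg_mx rG.
Proof.
move=> Gh; rewrite -scalemxAl mulmx_suml; congr (_ *: _).
rewrite [RHS](reindex_inj (mulIg h)) /=; apply: eq_big => g.
  by rewrite groupMr.
by move=> Gg; rewrite repr_mxM.
Qed.

Lemma mul_repr_avg n (rG : mx_representation rat G n) h :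
  h \in G -> rG h *m avg_mx rG = avg_mx rG.
Proof.
move=> Gh; rewrite -scalemxAr mulmx_sumr; congr (_ *: _).
rewrite [RHS](reindex_inj (mulgI h)) /=; apply: eq_big => g.
  by rewrite groupMl.
by move=> Gg; rewrite repr_mxM.
Qed.

Lemma avg_mx_id n (rG : mx_representation rat G n) :
  avg_mx rG *m avg_mx rG = avg_mx rG.
Proof. by apply: avg_mx_fix => g Gg; apply: avg_mxJ. Qed.

(** Write P = CR with C of full column rank and R of full row rank. Idempotency forces RC to be the
    identity of size the rank, and the trace of CR is that of RC. *)
Lemma mxtrace_idem n (P : 'M[rat]_n) : P *m P = P -> \tr P = (\rank P)%:R.
Proof.
move=> idP; rewrite -{1}[P]mulmx_base mxtrace_mulC.
suff -> : row_base P *m col_base P = 1%:M by rewrite mxtrace1.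
have /row_free_inj injR := row_base_free P.
have /row_full_inj injC := col_base_full P.
apply: injR; apply: injC.
rewrite mul1mx -[_ *m col_base P *m _]mulmxA mulmx_base.
by rewrite (mulmxA (col_base P) (row_base P)) mulmx_base.
Qed.

(** The inner product with the trivial character is the average of the traces, that is, the trace of
    the averaging projector, which is idempotent. *)
Lemma trivial_multE n (rG : mx_representation rat G n) :
  trivial_mult rG = (\rank (avg_mx rG))%:R.
Proof.
rewrite /trivial_mult cfdotE.
under eq_bigr => g Gg.
  rewrite cfunE cfun1E Gg conjC1 mulr1n mulr1.
  have -> : \tr (map_repr (ratr : {rmorphism rat -> algC}) rG g)
      = ratr (\tr (rG g)) by rewrite trace_map_mx.
  over.
rewrite -[RHS](rmorph_nat (ratr : {rmorphism rat -> algC})).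
rewrite -mxtrace_idem ?avg_mx_id // mxtraceZ raddf_sum.
by rewrite rmorphM fmorphV rmorph_nat rmorph_sum.
Qed.

Lemma mxmodule_avg n (rG : mx_representation rat G n) (U : 'M_n) :
  mxmodule rG U -> (U *m avg_mx rG <= U)%MS.
Proof.
move=> /mxmoduleP modU; rewrite -scalemxAr scalemx_sub // mulmx_sumr.
by apply: summx_sub => g Gg; apply: modU.
Qed.

Lemma rank_avg_submod n (rG : mx_representation rat G n) (U : 'M_n)
    (modU : mxmodule rG U) :
  \rank (avg_mx (submod_repr modU)) = \rank (U *m avg_mx rG).
Proof.
have -> : avg_mx (submod_repr modU)
    = in_submod U (val_submod (1%:M : 'M_(\rank U)) *m avg_mx rG).
  rewrite -scalemxAr in_submodE -scalemxAl mulmx_sumr mulmx_suml.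
  by congr (_ *: _); apply: eq_bigr => g Gg; rewrite -in_submodE.
have eqU := eqmxMr (avg_mx rG) (val_submod1 U).
by rewrite mxrank_in_submod eqU ?mxmodule_avg.
Qed.

Lemma in_factmod_avg n (rG : mx_representation rat G n) (U : 'M_n)
    (modU : mxmodule rG U) k (W : 'M_(k, n)) :
  in_factmod U W *m avg_mx (factmod_repr modU) = in_factmod U (W *m avg_mx rG).
Proof.
rewrite -!scalemxAr (in_factmodE _ (_ *: _)) -scalemxAl !mulmx_sumr mulmx_suml.
congr (_ *: _); apply: eq_bigr => g Gg.
by rewrite -(in_factmodJ modU) // in_factmodE.
Qed.

(** Averaging commutes with passing to the quotient by U, so invariants of the section are the image
    of the averaged V there. Adding the rank of U avoids a subtraction. *)
Lemma rank_avg_section n (rG : mx_representation rat G n) (U V : 'M_n)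
    (modU : mxmodule rG U) (modV : mxmodule rG V) :
  (\rank (avg_mx (section_repr modU modV)) + \rank U)%N
  = \rank (U + V *m avg_mx rG)%MS.
Proof.
rewrite rank_avg_submod (eqmxMr _ (genmxE _)) in_factmod_avg.
exact: mxrank_in_factmod.
Qed.

(** Rank-nullity for B on the image of P. Since P fixes its own image, the part of the kernel lying
    in that image is the kernel multiplied by P. *)
Lemma rank_ker_idem n k (P : 'M[rat]_n) (B : 'M_(n, k)) :
    P *m P = P -> (kermx B *m P <= kermx B)%MS ->
  (\rank (P *m B) + \rank (kermx B *m P) = \rank P)%N.
Proof.
move=> idP sKP; rewrite -(mxrank_mul_ker P B); congr (_ + _)%N.
apply/esym/eqmx_rank/andP; split; last by rewrite sub_capmx submxMl.
set C := (P :&: kermx B)%MS.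
have /submxP[W defW] : (C <= P)%MS := capmxSl _ _.
have CP : C *m P = C by rewrite defW -mulmxA idP.
by rewrite -[X in (X <= _)%MS]CP submxMr // capmxSr.
Qed.

End Averaging.

(** * Flags of subsets *)

Section Flags.

Variable n : nat.
Implicit Types (A B : {set 'I_n}) (G H F : {set {set 'I_n}}) (T : {fset nat}).

Definition nested G : bool :=
  [forall A in G, forall B in G, (A \subset B) || (B \subset A)].

Lemma nestedP G :
  reflect {in G &, forall A B, (A \subset B) || (B \subset A)} (nested G).
Proof.
apply: (iffP forall_inP) => [nG A B GA GB|nG A GA].
  exact: (forall_inP (nG A GA)).
by apply/forall_inP => B; apply: nG.
Qed.

Lemma nestedS G H : G \subset H -> nested H -> nested G.
Proof.
move=> /subsetP sGH /nestedP nH; apply/nestedP => A B /sGH HA /sGH.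
exact: nH.
Qed.

Lemma nested_sub G A B :
  nested G -> A \in G -> B \in G -> #|A| <= #|B| -> A \subset B.
Proof.
move=> /nestedP nG GA GB leAB; case/orP: (nG A B GA GB) => // sBA.
have [leBA] := subset_leqif_card sBA.
by rewrite eqn_leq leBA leAB => /esym.
Qed.

Lemma nested_inj G : nested G -> {in G &, injective (fun A => #|A|)}.
Proof.
move=> nG A B GA GB /eqP; rewrite eqn_leq => /andP[leAB leBA].
by apply/eqP; rewrite eqEsubset !(nested_sub nG).
Qed.

Definition tchain T G : bool := nested G && [forall A in G, #|A| \in T].

Lemma tchain_nested T G : tchain T G -> nested G.
Proof. by case/andP. Qed.

Lemma tchain_mem T G A : tchain T G -> A \in G -> #|A| \in T.
Proof. by case/andP=> _ /forall_inP; apply. Qed.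

Lemma tchainS T G H : G \subset H -> tchain T H -> tchain T G.
Proof.
move=> sGH /andP[nH /forall_inP HT]; rewrite /tchain (nestedS sGH nH) /=.
by apply/forall_inP => A /(subsetP sGH)/HT.
Qed.

Lemma tchain_sizes T G : tchain T G ->
  exists2 S : {fset nat}, (S `<=` T)%fset
    & #|` S| = #|G| /\ (forall t, t \in S <-> exists2 A, A \in G & #|A| = t).
Proof.
move=> cG; exists [fset #|A| | A : {set 'I_n} in G]%fset.
  by apply/fsubsetP => t /imfsetP[A /= GA ->]; apply: tchain_mem cG GA.
split.
  rewrite card_in_imfset /= ?cardE //.
  exact: nested_inj (tchain_nested cG).
move=> t; split=> [/imfsetP[A /= GA ->]|[A GA <-]]; first by exists A.
exact: in_imfset.
Qed.

Lemma tchain_card T G : tchain T G -> #|G| <= #|` T|.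
Proof. by case/tchain_sizes => S sST [<- _]; apply: fsubset_leq_card. Qed.

(** Members of a nested family have distinct sizes, so the cardinality condition means exactly one
    member of each size in [T]. *)
Definition flags T : {set {set {set 'I_n}}} :=
  [set F | tchain T F && (#|F| == #|` T|)].

Lemma flagsP T F : reflect (tchain T F /\ #|F| = #|` T|) (F \in flags T).
Proof. by rewrite inE; apply: (iffP andP) => -[cF /eqP]. Qed.

Lemma flags_mem T F t : F \in flags T -> t \in T ->
  exists2 A, A \in F & #|A| = t.
Proof.
case/flagsP => cF cardF Tt; have [S sST [cardS memS]] := tchain_sizes cF.
apply/memS; suff /eqP -> : S == T by [].
by rewrite eqEfcard sST cardS cardF leqnn.
Qed.

(* A member of G is a descent when exchanging some b < a across it, without
   touching the other members, decreases the sum of its elements. *)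
Definition descent G A : bool :=
  [exists a in A, exists b in ~: A,
     (b < a) && [forall B in G :\ A, (a \in B) == (b \in B)]].

Definition descending G : bool := [forall A in G, descent G A].

Definition weight G : nat := \sum_(A in G) \sum_(a in A) a.

Lemma sum_ord_exchange A B :
    #|A| = #|B| -> A != B ->
    {in A :\: B & B :\: A, forall a b : 'I_n, a < b} ->
  \sum_(a in A) a < \sum_(b in B) b.
Proof.
move=> cAB neAB ltAB; rewrite (big_setID B) /= [ltnRHS](big_setID A) /= setIC.
rewrite ltn_add2l; set P := A :\: B; set Q := B :\: A.
have cPQ : #|P| = #|Q|.
  by apply/(@addnI #|A :&: B|); rewrite cardsID setIC cardsID.
have P0 : 0 < #|P|.
  rewrite card_gt0; apply: contra neAB; rewrite setD_eq0 => sAB.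
  by rewrite eqEcard sAB cAB leqnn.
(* Summing over all pairs needs no bijection between P and Q; their common size cancels afterwards,
   and the successor keeps the inequality strict. *)
have : \sum_(a in P) \sum_(b in Q) a.+1 <= \sum_(a in P) \sum_(b in Q) b.
  by apply: leq_sum => a Pa; apply: leq_sum => b Qb; apply: ltAB.
rewrite [leqRHS]sum_nat_const; under eq_bigr do rewrite sum_nat_const mulnS.
rewrite big_split /= sum_nat_const -big_distrr /= -cPQ -mulnDr leq_pmul2l //.
by rewrite -addn1; apply: leq_trans; rewrite addnC leq_add2r.
Qed.

(** Another member contains both A and B if it is larger, and lies in both if it is smaller. So it
    does not separate an element lost from A from one gained in B, and if the gained one were
    smaller, A would be a descent. *)
Lemma weight_exchange G A B :
    nested G -> A \in G -> ~~ descent G A -> #|B| = #|A| -> B != A ->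
    nested (B |: G :\ A) ->
  weight G < weight (B |: G :\ A).
Proof.
move=> nG GA nd cBA neBA nG'; have B'G : B \notin G :\ A.
  apply/negP => /setD1P[_ GB]; case/eqP: neBA.
  exact: nested_inj nG _ _ GB GA cBA.
rewrite /weight (big_setU1 _ B'G) /= (big_setD1 A GA) /= ltn_add2r.
apply: sum_ord_exchange; rewrite ?cBA // 1?eq_sym // => a b.
rewrite !inE => /andP[nBa Aa] /andP[nAb Bb]; rewrite ltnNge; apply/negP => leba.
case/negP: nd; apply/exists_inP; exists a => //; apply/exists_inP; exists b.
  by rewrite inE.
rewrite ltn_neqAle leba andbT; apply/andP; split.
  by apply: contraNneq nBa => /val_inj <-.
apply/forall_inP => C CG'; have /setD1P[neCA GC] := CG'.
have G'B : B \in B |: G :\ A by rewrite setU11.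
have G'C : C \in B |: G :\ A by rewrite setU1r.
have [leAC|ltCA] := leqP #|A| #|C|.
  have /subsetP/(_ a Aa) -> := nested_sub nG GA GC leAC.
  have leBC : #|B| <= #|C| by rewrite cBA.
  by have /subsetP/(_ b Bb) -> := nested_sub nG' G'B G'C leBC.
have /subsetP/(_ b) sCA := nested_sub nG GC GA (ltnW ltCA).
have leCB : #|C| <= #|B| by rewrite cBA ltnW.
have /subsetP/(_ a) sCB := nested_sub nG' G'C G'B leCB.
by rewrite (negPf (contra sCA nAb)) (negPf (contra sCB nBa)).
Qed.

(** * Linear relations among indicators of flags *)

Section Span.

Local Open Scope ring_scope.

Variable T : {fset nat}.

Definition above G : 'rV[rat]_#|flags T| :=
  \row_(i < #|flags T|) (G \subset (enum_val i : {set {set 'I_n}}))%:R.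

(** A flag has exactly one member of size t, so exactly one summand on the right sees it when it
    refines G. *)
Lemma above_split G t : t \in T ->
  above G = \sum_(A : {set 'I_n} | #|A| == t) above (A |: G).
Proof.
move=> Tt; apply/rowP => i; rewrite summxE mxE.
have [A FA cA] := flags_mem (enum_valP i) Tt.
have [cF _] := flagsP _ _ (enum_valP i).
rewrite (bigD1 A) ?cA //= mxE subUset sub1set FA big1 ?addr0 // => B /andP[/eqP cB neBA].
rewrite mxE subUset sub1set (_ : _ \in _ = false) //.
apply: contraNF neBA => FB; apply/eqP/(nested_inj (tchain_nested cF)) => //.
by rewrite cB cA.
Qed.

Lemma above_not_nested G : ~~ nested G -> above G = 0.
Proof.
move=> nG; apply/rowP => i; rewrite !mxE (_ : _ \subset _ = false) //.
have [cF _] := flagsP _ _ (enum_valP i).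
by apply: contraNF nG => /nestedS; apply; apply: tchain_nested cF.
Qed.

Lemma above_flag (i : 'I_#|flags T|) : above (enum_val i) = delta_mx 0 i.
Proof.
apply/rowP => j; rewrite !mxE eqxx /= -(inj_eq enum_val_inj) eq_sym.
have [_ ci] := flagsP _ _ (enum_valP i).
have [_ cj] := flagsP _ _ (enum_valP j).
by rewrite eqEcard ci cj leqnn andbT.
Qed.

(* Induction along increasing weight, rewriting [above G] by [above_split]
   applied to [G :\ A] for a member [A] which is not a descent. *)
Lemma above_span k (W : 'M_(k, _)) G :
    tchain T G ->
    (forall H, tchain T H -> (#|H|.+1 = #|G|)%N -> (above H <= W)%MS) ->
    (forall H, tchain T H -> #|H| = #|G| -> descending H -> (above H <= W)%MS) ->
  (above G <= W)%MS.
Proof.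
(* No family outweighs the family of all subsets, so this difference drops as the weight grows. *)
have [N] := ubnP (weight [set: {set 'I_n}] - weight G).
elim: N G => // N IHN G; rewrite ltnS => leN cG Wfacet Wdesc.
have [/Wdesc->//|] := boolP (descending G).
rewrite negb_forall_in => /exists_inP[A GA ndA].
have TA := tchain_mem cG GA; have nG := tchain_nested cG.
have cGA : tchain T (G :\ A) by apply: tchainS cG; apply: subsetDl.
(* The relation for [G :\ A] at the size of A is solved for the summand A. What remains is a shorter
   chain and chains of larger weight. *)
have := above_split (G :\ A) TA; rewrite (bigD1 A) //= setD1K // => /esym.
move=> /(canRL (addrK _))->; rewrite addmx_sub //.
  by apply: Wfacet; rewrite // (cardsD1 A G) GA.
rewrite eqmx_opp; apply: summx_sub => B /andP[/eqP cB neBA].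
have [nG'|/above_not_nested->] := boolP (nested (B |: G :\ A)); last exact: sub0mx.
have B'G : B \notin G :\ A.
  apply/negP => /setD1P[_ GB]; case/eqP: neBA.
  exact: nested_inj nG _ _ GB GA cB.
have cardG' : #|B |: G :\ A| = #|G| by rewrite cardsU1 B'G (cardsD1 A G) GA.
apply: IHN; rewrite ?cardG' //.
  apply: leq_trans leN; apply: ltn_sub2l; last exact: weight_exchange.
  apply: leq_trans (weight_exchange nG GA ndA cB neBA nG') _.
  by rewrite /weight [leqRHS](big_setID (B |: G :\ A)) /= setTI leq_addr.
rewrite /tchain nG' /=; apply/forall_inP => C /setU1P[->|]; first by rewrite cB.
exact: tchain_mem cGA.
Qed.

(** The span whose rank turns out to be that of the averaged top boundary; its generators are chains
    missing one size of [T]. *)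
Definition facets : 'M[rat]_#|flags T| :=
  (\sum_(G | tchain T G && (#|G|.+1 == #|` T|)%N) <<above G>>)%MS.

(** As long as several sizes are missing, [above_split] at a missing size expresses the indicator
    through longer chains. *)
Lemma above_facets G : tchain T G -> (#|G| < #|` T|)%N -> (above G <= facets)%MS.
Proof.
have [k] := ubnP (#|` T| - #|G|)%N; elim: k G => // k IHk G; rewrite ltnS => lek cG.
rewrite leq_eqVlt => /predU1P[eqT|ltT].
  by rewrite -(genmxE (above G)); apply: (sumsmx_sup G); rewrite // cG eqT eqxx.
have [S sST [cardS memS]] := tchain_sizes cG.
have /fsubsetPn[t Tt nSt] : ~~ (T `<=` S)%fset.
  by apply: contraTN (ltnW ltT) => /fsubset_leq_card; rewrite cardS -leqNgt.
rewrite (above_split G Tt); apply: summx_sub => A /eqP cA.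
have [nG'|/above_not_nested->] := boolP (nested (A |: G)); last exact: sub0mx.
have A'G : A \notin G by apply/negP => GA; case/negP: nSt; apply/memS; exists A.
have cardG' : #|A |: G| = #|G|.+1 by rewrite cardsU1 A'G.
apply: IHk; rewrite ?cardG' //.
  by apply: leq_trans lek; rewrite ltn_sub2l // ltnW.
rewrite /tchain nG' /=; apply/forall_inP => C /setU1P[->|]; first by rewrite cA.
exact: tchain_mem cG.
Qed.

Lemma rank_sum_above (Q : {set {set {set 'I_n}}}) :
  (\rank (\sum_(G in Q) <<above G>>)%MS <= #|Q|)%N.
Proof.
rewrite -[leqRHS]sum1_card; elim/big_rec2: _ => [|G k W _ leW]; first by rewrite mxrank0.
by apply: leq_trans (mxrank_adds_leqif _ _) _; rewrite genmxE leq_add ?rank_leq_row.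
Qed.

(** By induction on the length, [above_span] puts every chain shorter than a flag in the span of the
    descending ones. *)
Lemma facets_rank_le :
  (\rank facets
     <= #|[set G | [&& tchain T G, descending G & #|G| < #|` T|]]|)%N.
Proof.
apply: leq_trans (rank_sum_above _); apply: mxrankS.
set W := (\sum_(G in _) _)%MS.
suff sW k G : tchain T G -> (#|G| < #|` T|)%N -> (#|G| = k)%N -> (above G <= W)%MS.
  by apply/sumsmx_subP => G /andP[cG /eqP eqT]; rewrite genmxE (sW #|G|) ?eqT.
elim/ltn_ind: k G => k IHk G cG ltT eqk; apply: above_span cG _ _ => H cH.
  move=> eqH; apply: IHk (erefl _); rewrite // -?eqk -?eqH //.
  by apply: ltnW; rewrite eqH.
move=> eqH dH; rewrite -(genmxE (above H)); apply: (sumsmx_sup H) => //.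
by rewrite inE cH dH eqH.
Qed.

(** The indicator of a full flag is a unit vector, and [above_span] places it in the span of shorter
    chains and descending flags. Together these therefore fill the whole space. *)
Lemma facets_rank_ge :
  (#|flags T|
     <= \rank facets + #|[set F in flags T | descending F]|)%N.
Proof.
rewrite -[leqLHS](mxrank1 rat).
pose W := (\sum_(F in [set F in flags T | descending F]) <<above F>>)%MS.
apply: (@leq_trans (\rank (facets + W)%MS)); last first.
  apply: leq_trans (mxrank_adds_leqif _ _) _.
  by rewrite leq_add2l; apply: leq_trans (rank_sum_above _) _.
apply/mxrankS/row_subP => i; rewrite row1 -above_flag.
have [cF eqF] := flagsP _ _ (enum_valP i).
apply: above_span cF _ _ => H cH; rewrite eqF => eqH.
  by rewrite (submx_trans (above_facets cH _)) ?addsmxSl // -eqH.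
move=> dH; apply: submx_trans (addsmxSr _ _); rewrite -(genmxE (above H)).
by apply: (sumsmx_sup H) => //; rewrite !inE cH eqH eqxx.
Qed.

End Span.

End Flags.

(** * Permutations with given descents *)

Section Ranking.

Variable n : nat.

Lemma card_ord_ltn k : k <= n -> #|[set i : 'I_n | i < k]| = k.
Proof.
move=> lekn; rewrite -sum1dep_card -(big_ord_widen n (fun=> 1)) //.
by rewrite sum1_card card_ord.
Qed.

Lemma card_perm_ltn (p : 'S_n) k : k <= n -> #|[set a | p a < k]| = k.
Proof.
move=> lekn; rewrite -[RHS](card_ord_ltn lekn) -[RHS](card_preimset _ (@perm_inj _ p)).
by apply: eq_card => a; rewrite !inE.
Qed.

(** Each index goes to the number of smaller keys. This turns sorting by a key into a permutation;
    the keys used below are lexicographic pairs packed into one number. *)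
Lemma rank_perm (key : 'I_n -> nat) : injective key ->
  exists p : 'S_n, forall a b, (p a < p b) = (key a < key b).
Proof.
move=> inj_key; pose below a := [set b | key b < key a].
have lt_below a : #|below a| < n.
  rewrite -[ltnRHS]card_ord; apply: proper_card; apply/properP; split.
    exact/subsetP.
  by exists a; rewrite // inE ltnn.
have mono a b : (#|below a| < #|below b|) = (key a < key b).
  have [ltab|leba] := ltnP (key a) (key b).
    apply: proper_card; apply/properP; split; last by exists a; rewrite !inE ?ltnn.
    by apply/subsetP => c; rewrite !inE => /ltn_trans->.
  apply/negbTE; rewrite -leqNgt; apply/subset_leq_card/subsetP => c.
  by rewrite !inE => /leq_trans->.
have inj_rk : injective (fun a => Ordinal (lt_below a)).
  move=> a b [eqab]; apply: inj_key; apply/eqP.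
  by rewrite eqn_leq ![key _ <= _]leqNgt -!mono eqab ltnn.
by exists (perm inj_rk) => a b; rewrite !permE /= mono.
Qed.

Lemma perm_order_inj (p q : 'S_n) :
  (forall a b, (p a < p b) = (q a < q b)) -> p = q.
Proof.
move=> pq; apply/permP => a; apply: val_inj => /=.
rewrite -(card_perm_ltn p (ltnW (ltn_ord (p a)))).
rewrite -[RHS](card_perm_ltn q (ltnW (ltn_ord (q a)))).
by apply: eq_card => b; rewrite !inE pq.
Qed.

End Ranking.

(** * Descent sets and flags of permutations *)

Section Descents.

Variable n : nat.
Implicit Types (s : 'S_n) (S T : {fset nat}).

Lemma DesP s j : reflect (exists i i' : 'I_n,
    [/\ i.+1 = j, i' = j :> nat & s i' < s i]) (j \in Des s).
Proof.
rewrite !inE /= mem_iota; apply: (iffP andP) => [[_]|[i [i' [ij i'j lts]]]].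
  by case/existsP=> i /existsP[i' /and3P[/eqP ij /eqP i'j lts]]; exists i, i'.
split; first by have := ltn_ord i'; lia.
by apply/existsP; exists i; apply/existsP; exists i'; rewrite ij i'j !eqxx.
Qed.

(** No step between the two positions is at an element of [T], so each is an ascent, and ascents
    compose. *)
Lemma Des_ascent s T (i j : 'I_n) : (Des s `<=` T)%fset ->
  i < j -> (forall t, t \in T -> ~~ (i < t <= j)) -> s i < s j.
Proof.
move=> /fsubsetP sT; case: j => j; elim: j => // j IHj ltj /=.
rewrite ltnS => leij noT; have ltj' := ltnW ltj.
have lts : s (Ordinal ltj') < s (Ordinal ltj).
  rewrite ltn_neqAle (inj_eq val_inj) (inj_eq perm_inj) -val_eqE /= neq_ltn ltnSn /=.
  rewrite leqNgt; apply/negP => desj.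
  have /sT/noT : j.+1 \in Des s by apply/DesP; exists (Ordinal ltj'), (Ordinal ltj).
  by rewrite ltnS leij ltnSn.
have [ltij|leji] := ltnP i j.
  apply: ltn_trans lts; apply: IHj => // t /noT; apply: contra => /andP[-> /leqW].
  by [].
by rewrite (_ : i = Ordinal ltj') //; apply: val_inj; apply/eqP; rewrite eqn_leq leij.
Qed.

(** The letters in the first t positions of the word of s. *)
Definition prefix_set s t : {set 'I_n} := [set a | (s^-1)%g a < t].

Lemma card_prefix_set s t : t <= n -> #|prefix_set s t| = t.
Proof. exact: card_perm_ltn. Qed.

Definition flag s S : {set {set 'I_n}} :=
  [set prefix_set s t | t : 'I_n.+1 & (t : nat) \in S].

Lemma flagP s S A : (forall t, t \in S -> t <= n) ->
  reflect (exists2 t, t \in S & A = prefix_set s t) (A \in flag s S).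
Proof.
move=> leS; apply: (iffP imsetP) => [[t]|[t St ->]].
  by rewrite inE => St ->; exists (val t).
by exists (inord t); rewrite ?inE inordK // ltnS leS.
Qed.

Lemma prefix_set_sub s t u : t <= u -> prefix_set s t \subset prefix_set s u.
Proof. by move=> letu; apply/subsetP => a; rewrite !inE => /leq_trans->. Qed.

Lemma flag_flags s T : (forall t, t \in T -> t <= n) -> flag s T \in flags n T.
Proof.
move=> leT; apply/flagsP; split.
  apply/andP; split; last first.
    by apply/forall_inP => _ /(flagP _ _ leT)[t Tt ->]; rewrite card_prefix_set ?leT.
  apply/nestedP => _ _ /(flagP _ _ leT)[t Tt ->] /(flagP _ _ leT)[u Tu ->].
  by case/orP: (leq_total t u) => /prefix_set_sub-> //; rewrite orbT.
rewrite card_in_imset => [|t u _ _ eqtu].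
  rewrite cardE -(size_map val); apply/perm_size/uniq_perm => [||t].
  - by rewrite map_inj_uniq ?enum_uniq //; apply: val_inj.
  - exact: fset_uniq.
  apply/mapP/idP => [[u]|Tt]; first by rewrite mem_enum inE => Tu ->.
  by exists (inord t); rewrite ?mem_enum ?inE /= inordK // ltnS leT.
apply: val_inj => /=.
rewrite -(card_prefix_set s (_ : t <= n)) -1?ltnS // eqtu.
by rewrite card_prefix_set // -ltnS.
Qed.

(** The flag tells which letters lie before each position in [T]. Letters separated by such a
    position are thereby ordered, and the others appear in increasing order because no descent falls
    between them. *)
Lemma flag_inj T : (forall t, t \in T -> t <= n) ->
  {in [pred s | (Des s `<=` T)%fset] &, injective (fun s => flag s T)}.
Proof.
move=> leT s s'; rewrite !inE => sT s'T eqf; apply: invg_inj.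
have eqp t : t \in T -> prefix_set s t = prefix_set s' t.
  move=> Tt; have /(flagP _ _ leT)[u Tu eqtu] : prefix_set s t \in flag s' T.
    by rewrite -eqf; apply/flagP => //; exists t.
  by rewrite {2}(_ : t = u) // -(card_prefix_set s (leT t Tt)) eqtu card_prefix_set ?leT.
apply: perm_order_inj => a b.
have eqlt c t : t \in T -> ((s^-1)%g c < t) = ((s'^-1)%g c < t).
  by move=> /eqp/setP/(_ c); rewrite !inE.
have asc (r : 'S_n) x y : (Des r `<=` T)%fset -> (r^-1)%g x < (r^-1)%g y ->
    (forall t, t \in T -> ((r^-1)%g x < t) = ((r^-1)%g y < t)) -> x < y.
  move=> rT ltxy same; have := Des_ascent rT ltxy; rewrite !permKV; apply=> t Tt.
  by have := same t Tt; lia.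
have ascE (r : 'S_n) : (Des r `<=` T)%fset ->
    (forall t, t \in T -> ((r^-1)%g a < t) = ((r^-1)%g b < t)) ->
    ((r^-1)%g a < (r^-1)%g b) = (a < b).
  move=> rT same; case: (ltngtP ((r^-1)%g a) ((r^-1)%g b)) => [ltab|ltba|/val_inj/perm_inj->].
  - by rewrite (asc r).
  - by apply/esym/negbTE; rewrite -leqNgt ltnW // (asc r) // => t /same.
  - by rewrite ltnn.
have [/allP same|/allPn[t Tt]] :=
  boolP (all (fun t => ((s^-1)%g a < t) == ((s^-1)%g b < t)) T).
  rewrite !ascE // => t Tt; last by rewrite (eqP (same t Tt)).
  by rewrite -!eqlt // (eqP (same t Tt)).
move: (eqlt a t Tt) (eqlt b t Tt).
case: (ltnP ((s^-1)%g a) t) => lta; case: (ltnP ((s^-1)%g b) t) => ltb // /esym lta' /esym ltb' _.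
  have {}ltb' : t <= (s'^-1)%g b by rewrite leqNgt ltb'.
  by rewrite (leq_trans lta ltb) (leq_trans lta' ltb').
have {}lta' : t <= (s'^-1)%g a by rewrite leqNgt lta'.
rewrite [LHS]ltnNge [RHS]ltnNge (ltnW (leq_trans ltb lta)).
by rewrite (ltnW (leq_trans ltb' lta')).
Qed.

(** Sort the letters by the number of members missing them, then by value, and read the result as a
    word. Its prefixes of the right sizes are the members of G; away from these sizes the word
    increases, and being a descent of G forces a fall at each of them. *)
Lemma descending_flag T G : (forall t, t \in T -> t <= n) ->
    tchain T G -> descending G ->
  exists s, [/\ (Des s `<=` T)%fset, #|` Des s| = #|G| & G = flag s (Des s)].
Proof.
move=> leT cG /forall_inP dG; have nG := tchain_nested cG.
have [S sST [cardS memS]] := tchain_sizes cG.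
have leS t : t \in S -> t <= n by move/(fsubsetP sST)/leT.
pose blk a := #|[set A in G | a \notin A]|; pose key a := blk a * n + a.
have inj_key : injective key.
  move=> a b /(congr1 (modn^~ n)); rewrite /key !modnMDl !modn_small //.
  exact: val_inj.
have blk_lt A a b : A \in G -> a \in A -> b \notin A -> blk a < blk b.
  move=> GA Aa nAb; apply: proper_card; apply/properP; split.
    apply/subsetP => B; rewrite !inE => /andP[GB nBa]; rewrite GB /=.
    case/orP: (nestedP _ nG A B GA GB) => /subsetP sub.
      by rewrite sub in nBa.
    by apply: contra nAb; apply: sub.
  by exists A; rewrite !inE GA ?nAb ?Aa.
have key_lt A a b : A \in G -> a \in A -> b \notin A -> key a < key b.
  move=> GA Aa nAb; have := blk_lt A a b GA Aa nAb; rewrite /key.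
  by have := ltn_ord a; nia.
have [p pkey] := rank_perm inj_key.
have card_below a : #|[set b | key b < key a]| = p a.
  rewrite -[RHS](card_perm_ltn p (ltnW (ltn_ord _))).
  by apply: eq_card => b; rewrite !inE pkey.
have memA A a : A \in G -> (a \in A) = (p a < #|A|).
  move=> GA; have [Aa|nAa] := boolP (a \in A); apply/esym; last first.
    apply/negbTE; rewrite -leqNgt -card_below; apply/subset_leq_card/subsetP => b Ab.
    by rewrite inE (key_lt A).
  rewrite -card_below; apply: proper_card; apply/properP; split.
    apply/subsetP => b; rewrite inE => ltba; apply: contraLR ltba => nAb.
    by rewrite -leqNgt ltnW // (key_lt A).
  by exists a; rewrite // inE ltnn.
have p_same a b : (forall A, A \in G -> (a \in A) = (b \in A)) -> (p a < p b) = (a < b).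
  move=> same; rewrite pkey /key (_ : blk a = blk b) ?ltn_add2l //.
  by apply: eq_card => A; rewrite !inE; have [/same->|] := boolP (A \in G).
have prefA A : A \in G -> prefix_set p^-1 #|A| = A.
  by move=> GA; apply/setP => a; rewrite inE invgK memA.
have memDes (j : nat) : (j \in Des p^-1) = (j \in S).
  apply/DesP/idP => [[i [i' [ij i'j lts]]]|Sj].
    apply: contraLR lts => nSj; rewrite -leqNgt ltnW // -p_same ?permKV ?ij ?i'j //.
    move=> A GA; rewrite !memA // !permKV i'j -ij.
    have : #|A| != j by apply: contraNneq nSj => <-; apply/memS; exists A.
    by rewrite -ij; lia.
  have [A GA cA] := (memS j).1 Sj.
  case/exists_inP: (dG A GA) => a Aa /exists_inP[b].
  rewrite inE => nAb /andP[ltba /forall_inP same].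
  have ltaj : p a < j by rewrite -cA -memA.
  have lejb : j <= p b by rewrite leqNgt -cA -memA.
  have ltj : j < n := leq_ltn_trans lejb (ltn_ord _).
  have ltj' : j.-1 < n := leq_ltn_trans (leq_pred _) ltj.
  exists (Ordinal ltj'), (Ordinal ltj); split; rewrite //= ?prednK //.
    exact: leq_trans ltaj.
  (* These are the letters just before and just after the cut of A. No other member separates a from
     b, and c, d lie between them in sorted order, so a shares its members with c, and d with b.
     Ties are sorted by value, whence d <= b < a <= c. *)
  set c := p^-1%g (Ordinal ltj'); set d := p^-1%g (Ordinal ltj).
  have pc : p c = j.-1 :> nat by rewrite permKV.
  have pd : p d = j :> nat by rewrite permKV.
  have same_ab B : B \in G -> #|B| <> j -> (p a < #|B|) = (p b < #|B|).
    move=> GB ne; rewrite -!memA //; apply/eqP/same; rewrite !inE GB andbT.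
    by apply: contra_notN ne => /eqP->.
  have leac : a <= c.
    rewrite leqNgt -p_same => [|B GB]; first by rewrite pc; lia.
    rewrite !memA // pc; have [->|ne] := #|B| =P j; first lia.
    by have := same_ab B GB ne; lia.
  have ledb : d <= b.
    rewrite leqNgt -p_same => [|B GB]; first by rewrite pd; lia.
    rewrite !memA // pd; have [->|ne] := #|B| =P j; first lia.
    by have := same_ab B GB ne; lia.
  exact: leq_ltn_trans ledb (leq_trans ltba leac).
have defDes : Des p^-1 = S by apply/fsetP => j; apply: memDes.
exists p^-1%g; rewrite defDes; split=> //; apply/setP => A.
apply/idP/(flagP _ _ leS) => [GA|[t St ->]].
  by exists #|A|; [apply/memS; exists A | rewrite prefA].
by have [B GB <-] := (memS t).1 St; rewrite prefA.
Qed.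

(** Cut the positions at the elements of [T] and give each block smaller values than the block
    before it, increasing inside the block. *)
Lemma Des_surj T : (forall t, t \in T -> 0 < t < n) -> exists s, Des s = T.
Proof.
move=> ltT; pose desc i := count (fun t => t <= i) T.
pose key (i : 'I_n) := (size T - desc i) * n + i.
have inj_key : injective key.
  move=> a b /(congr1 (modn^~ n)); rewrite /key !modnMDl !modn_small //.
  exact: val_inj.
have [s skey] := rank_perm inj_key.
have desc_le i : desc i <= size T by apply: count_size.
have descS i : desc i.+1 = (i.+1 \in T) + desc i.
  rewrite -(count_uniq_mem _ (fset_uniq T)) /desc.
  elim: (enum_fset T) => //= t r ->; lia.
suff memDes (j : nat) : (j \in Des s) = (j \in T) by exists s; apply/fsetP/memDes.
apply/DesP/idP => [[i [i' [ij i'j]]]|Tj].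
  rewrite skey /key i'j -ij descS ij; case: (j \in T) => //.
  by rewrite add0n; lia.
have /andP[j0 ltj] := ltT j Tj.
have ltj' : j.-1 < n := leq_ltn_trans (leq_pred _) ltj.
exists (Ordinal ltj'), (Ordinal ltj); split; rewrite //= ?prednK //.
rewrite skey /key /=; have := desc_le j.
have -> : desc j = (desc j.-1).+1 by rewrite -{1}(prednK j0) descS prednK // Tj.
by move/subnSK=> <-; rewrite mulSnr -addnA ltn_add2l; lia.
Qed.

(** A cycle of inequalities: permutations with descents inside [T] inject into flags, flags are
    bounded by the rank plus the descending flags, and these two by the permutations with descent
    set strictly inside [T] and equal to [T]. *)
Theorem rank_facets T : (forall t, t \in T -> t <= n) ->
  #|flags n T| = \rank (facets n T) + #|[set s : 'S_n | Des s == T]|.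
Proof.
move=> leT; set b := #|[set s : 'S_n | Des s == T]|; set c := #|[set s : 'S_n | (Des s `<` T)%fset]|.
(* A descending chain is the flag of some permutation at that permutation's own descent set; D
   records what Q imposes on this set. *)
have desc_card (Q : pred {set {set 'I_n}}) (D : pred {fset nat}) :
    (forall G, Q G -> tchain T G && descending G) ->
    (forall G S, Q G -> (S `<=` T)%fset -> #|` S| = #|G| -> D S) ->
  #|[set G | Q G]| <= #|[set s : 'S_n | D (Des s)]|.
  move=> QG QD.
  have sub : [set G | Q G] \subset
      [set flag s (Des s) | s in [set s : 'S_n | D (Des s)]].
    apply/subsetP => G; rewrite inE => QGG; have /andP[cG dG] := QG G QGG.
    have [s [sT cs ->]] := descending_flag leT cG dG.
    by apply: imset_f; rewrite inE (QD G).
  exact: leq_trans (subset_leq_card sub) (leq_imset_card _ _).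
have leb : #|[set F in flags n T | descending F]| <= b.
  apply: (desc_card (fun F => (F \in flags n T) && descending F)
                    (fun S => S == T)).
    by move=> G /andP[/flagsP[-> _] ->].
  move=> G S /andP[/flagsP[_ cG] _] sST cS /=.
  by rewrite eqEfcard sST cS cG leqnn.
have lec : \rank (facets n T) <= c.
  apply: leq_trans (facets_rank_le n T) _.
  apply: (desc_card (fun G => [&& tchain T G, descending G & #|G| < #|` T|])
                    (fun S => (S `<` T)%fset)).
    by move=> G /and3P[-> ->].
  by move=> G S /and3P[_ _ ltG] sST cS; rewrite fproperEcard sST cS.
have lebc : b + c <= #|flags n T|.
  have -> : b + c = #|[set s : 'S_n | (Des s `<=` T)%fset]|.
    rewrite -(cardsID [set s : 'S_n | Des s == T]); congr (_ + _).
      by apply: eq_card => s; rewrite !inE; case: eqP => [->|]; rewrite ?fsubset_refl ?andbF.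
    by apply: eq_card => s; rewrite !inE fproperEneq.
  rewrite -(card_in_imset (f := fun s => flag s T)) => [|s s'].
    apply: subset_leq_card; apply/subsetP => _ /imsetP[s _ ->].
    exact: flag_flags.
  by rewrite !inE => sT s'T; apply: (flag_inj leT).
have := facets_rank_ge n T; lia.
Qed.

End Descents.

(** * Cuts of ordered set partitions *)

Section LevelCoding.

Variable m : nat.
Implicit Types (x y : osp m) (f : 'I_m -> nat) (g : 'S_m).

Lemma osp_inj x y : x = y :> seq {set 'I_m} -> x = y.
Proof. by move=> eqxy; do 2 apply: val_inj. Qed.

Lemma in_bigcup_seq (s : seq {set 'I_m}) e :
  (e \in \bigcup_(B <- s) B) = has (fun B : {set 'I_m} => e \in B) s.
Proof. by elim: s => [|B s IHs]; rewrite ?big_nil ?big_cons inE //= IHs. Qed.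

(** An ordered set partition is handled through the function giving the index of the block of each
    letter. *)
Definition level_seq f K : seq {set 'I_m} := mkseq (fun k => [set e | f e == k]) K.

Definition levels f K := (forall e, f e < K) /\ (forall k, k < K -> exists e, f e = k).

Lemma is_osp_level_seq f K : levels f K -> is_osp (level_seq f K).
Proof.
case=> ltf ontof; apply/and3P; split.
- apply/mapP => -[k]; rewrite mem_iota => /ontof[e fe] /setP/(_ e).
  by rewrite !inE fe eqxx.
- rewrite eqEsubset subsetT; apply/subsetP => e _.
  rewrite in_bigcup_seq has_map; apply/hasP; exists (f e); first by rewrite mem_iota ltf.
  by rewrite /= inE.
- rewrite pairwise_map; have := iota_uniq 0 K; rewrite uniq_pairwise.
  apply: sub_pairwise => k l /= nekl; rewrite disjoints_subset; apply/subsetP => e.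
  by rewrite !inE => /eqP->.
Qed.

Definition osp_of_levels f K (fK : levels f K) : osp m :=
  @Osp m (Bseq (osp_size_le (is_osp_level_seq fK))) (is_osp_level_seq fK).

Lemma osp_levels x : exists2 f, levels f (size x) & x = level_seq f (size x) :> seq _.
Proof.
case: x => /= x /and3P[x0 /eqP xU xD].
pose f e := find (fun B : {set 'I_m} => e \in B) x.
have ltf e : f e < size x by rewrite /f -has_find -in_bigcup_seq xU.
have memf e : e \in nth set0 x (f e).
  by have := ltf e; rewrite -has_find => /(nth_find set0).
have fP e k : k < size x -> (e \in nth set0 x k) = (f e == k).
  move=> ltk; apply/idP/eqP => [ek|<-//].
  have dis i j : i < j -> j < size x -> e \in nth set0 x i -> e \in nth set0 x j -> False.
    move=> ltij ltj ei ej; have := (pairwiseP set0 xD) i j.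
    rewrite !inE ltj (ltn_trans ltij ltj) => /(_ isT isT ltij).
    by rewrite disjoints_subset => /subsetP/(_ e ei); rewrite inE ej.
  by case: (ltngtP (f e) k) => // lt; case: (dis _ _ lt).
exists f.
  split=> // k ltk; have : nth set0 x k != set0.
    by apply: contraNneq x0 => <-; apply: mem_nth.
  by case/set0Pn=> e; rewrite fP // => /eqP; exists e.
apply: (@eq_from_nth _ set0); rewrite ?size_mkseq // => k ltk.
by rewrite nth_mkseq //; apply/setP => e; rewrite fP // inE.
Qed.

(** The block index after blocks i and i + 1 are merged: larger indices drop by one. *)
Definition merge_level i f (e : 'I_m) : nat := f e - (i < f e).

Lemma merge_level_seq f K i : i.+1 < K ->
  take i (level_seq f K)
    ++ (nth set0 (level_seq f K) i :|: nth set0 (level_seq f K) i.+1)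
    :: drop i.+2 (level_seq f K)
  = level_seq (merge_level i f) K.-1.
Proof.
move=> ltiK; have ltiK' := ltnW ltiK.
have eqK : i + (K - i.+2).+1 = K.-1 by lia.
set s := level_seq f K; have sizes : size s = K by rewrite size_mkseq.
have sizet : size (take i s) = i by rewrite size_takel // sizes ltnW.
apply: (@eq_from_nth _ set0) => [|k]; rewrite size_cat /= sizet size_drop sizes eqK.
  by rewrite size_mkseq.
move=> ltk; rewrite [RHS]nth_mkseq // nth_cat sizet; clear sizes sizet.
have ltkK : k.+1 < K by lia.
have [ltki|leik] := ltnP k i.
  rewrite nth_take // nth_mkseq 1?ltnW //.
  by apply/setP => e; rewrite !inE /merge_level; clear -ltki; lia.
have [->|neki] := eqVneq k i.
  rewrite subnn /= !nth_mkseq //.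
  by apply/setP => e; rewrite !inE /merge_level; clear; lia.
have ltik : i < k by rewrite ltn_neqAle eq_sym neki.
rewrite (_ : k - i = (k - i.+1).+1) /= ?subnSK // nth_drop (_ : i.+2 + _ = k.+1); last lia.
rewrite nth_mkseq //.
by apply/setP => e; rewrite !inE /merge_level; clear -ltik; lia.
Qed.

Lemma osp_cover_levels x y f K : x = level_seq f K :> seq _ ->
  osp_cover x y <->
  exists2 i, i.+1 < K & y = level_seq (merge_level i f) K.-1 :> seq _.
Proof.
move=> def_x; have sizex : size x = K by rewrite def_x size_mkseq.
split=> [/existsP[i]|[i ltiK def_y]].
  rewrite sizex => /andP[ltiK /eqP->]; exists i => //.
  by rewrite def_x merge_level_seq.
have ltim : i < m.
  by apply: leq_trans (size_bseq (osp_blocks x)); rewrite sizex ltnW.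
apply/existsP; exists (Ordinal ltim); rewrite /= sizex ltiK def_y.
by rewrite def_x merge_level_seq // eqxx.
Qed.

Lemma osp_act_levels x f K g : x = level_seq f K :> seq _ ->
  osp_act x g = level_seq (fun e => f ((g^-1)%g e)) K :> seq _.
Proof.
move=> /= def_x; rewrite def_x /osp_act_seq /level_seq /mkseq -map_comp.
apply: eq_map => k /=; apply/setP => e; rewrite inE.
apply/imsetP/idP => [[c]|fe]; first by rewrite inE => fc ->; rewrite permK.
by exists ((g^-1)%g e); rewrite ?inE ?permKV.
Qed.

End LevelCoding.

(** * Ordered set partitions up to permutation of letters *)

Section Cuts.

Variable n : nat.
Local Notation m := n.+1.
Implicit Types (A B : {set 'I_n}) (x y : osp m) (g : 'S_m).

(* A cut a separates the letters up to a from the letters after a. *)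
Definition level A (e : nat) : nat := #|[set a in A | a < e]|.

Lemma level_le A e e' : e <= e' -> level A e <= level A e'.
Proof.
move=> le; apply/subset_leq_card/subsetP => a; rewrite !inE => /andP[-> /leq_trans->] //.
Qed.

Lemma level_lt A (a : 'I_n) e : a \in A -> (level A a < level A e) = (a < e).
Proof.
move=> Aa; have [ltae|leea] := ltnP a e; last by rewrite ltnNge level_le.
apply: proper_card; apply/properP; split.
  by apply/subsetP => b; rewrite !inE => /andP[-> /ltn_trans->].
by exists a; rewrite !inE ?Aa ?ltae ?ltnn.
Qed.

Lemma level0 A : level A 0 = 0.
Proof. by apply: eq_card0 => a; rewrite !inE andbF. Qed.

Lemma level_max A e : n <= e -> level A e = #|A|.
Proof.
by move=> le; apply: eq_card => a; rewrite !inE (leq_trans (ltn_ord a) le) andbT.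
Qed.

Lemma level_le_card A e : level A e <= #|A|.
Proof. by apply/subset_leq_card/subsetP => a; rewrite inE => /andP[]. Qed.

Lemma levelS A (a : 'I_n) : level A a.+1 = level A a + (a \in A).
Proof.
rewrite /level (cardsD1 a) !inE ltnSn andbT addnC; congr (_ + _).
by apply: eq_card => b; rewrite !inE ltnS -val_eqE /=; case: (b \in A); lia.
Qed.

(** The level climbs from 0 to the number of cuts, by one at each cut and by nothing elsewhere. *)
Lemma level_onto A k : k < #|A| -> exists2 a, a \in A & level A a = k.
Proof.
rewrite -(level_max A (leqnn n)).
have : n <= n by []; elim: {1 3}n => [|N IHN] leN; first by rewrite level0.
rewrite (levelS A (Ordinal leN)) /=.
have [/(IHN (ltnW leN))//|le] := ltnP k (level A N).
case: (boolP (Ordinal leN \in A)) => [AN lt|_]; last by rewrite addn0 ltnNge le.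
by exists (Ordinal leN) => //=; lia.
Qed.

Lemma level_levels A : levels (fun e : 'I_m => level A e) #|A|.+1.
Proof.
split=> [e|k]; first by rewrite ltnS level_le_card.
rewrite ltnS leq_eqVlt => /predU1P[->|/level_onto[a _ <-]].
  by exists ord_max; rewrite level_max.
by exists (widen_ord (leqnSn n) a).
Qed.

(** The orbit representative whose blocks are intervals, separated at the cuts in A. *)
Definition osp0 A : osp m := osp_of_levels (level_levels A).

Lemma osp0E A : osp0 A = level_seq (fun e : 'I_m => level A e) #|A|.+1 :> seq _.
Proof. by []. Qed.

Lemma merge_level_cut A a : a \in A ->
  merge_level (level A a) (fun e : 'I_m => level A e) =1 (fun e => level (A :\ a) e).
Proof.
move=> Aa e; rewrite /merge_level level_lt // [X in X - _]/level (cardsD1 a) inE Aa /=.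
rewrite addKn; apply: eq_card => b; rewrite !inE andbA; congr (_ && _).
Qed.

Lemma osp0_cover A y : osp_cover (osp0 A) y <-> exists2 a, a \in A & y = osp0 (A :\ a).
Proof.
have cut a : a \in A ->
    level_seq (merge_level (level A a) (fun e : 'I_m => level A e)) #|A| = osp0 (A :\ a).
  move=> Aa; rewrite osp0E (cardsD1 a A) Aa /=.
  apply: eq_map => k; apply/setP => e; rewrite !inE.
  by rewrite merge_level_cut.
split=> [/(osp_cover_levels _ (osp0E A))[i]|[a Aa ->]].
  rewrite ltnS => /level_onto[a Aa <-] /=; rewrite cut // => eqy.
  by exists a => //; apply: osp_inj.
apply/(osp_cover_levels _ (osp0E A)); exists (level A a); last by rewrite /= cut.
by rewrite ltnS -(level_max A (leqnn n)) level_lt.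
Qed.

Lemma osp0_le A B : B \subset A -> osp_le (osp0 A) (osp0 B).
Proof.
have [k] := ubnP #|A|; elim: k A => // k IHk A; rewrite ltnS => leA sBA.
have [sAB|/subsetPn[a Aa nBa]] := boolP (A \subset B).
  have -> : A = B by apply/eqP; rewrite eqEsubset sAB.
  exact: connect0.
apply: (@connect_trans _ _ (osp0 (A :\ a))).
  by apply/connect1/osp0_cover; exists a.
by apply: IHk; [rewrite (cardsD1 a A) Aa in leA | rewrite subsetD1 sBA].
Qed.

Lemma osp0_act_le A g y : osp_le (osp_act (osp0 A) g) y ->
  exists2 B : {set 'I_n}, B \subset A & y = osp_act (osp0 B) g.
Proof.
case/connectP=> p; elim: p A => [|z p IHp] A /=; first by move=> _ ->; exists A.
case/andP=> /(osp_act_cover g^-1%g); rewrite -osp_actM mulgV osp_act1.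
case/osp0_cover=> a Aa def_z; rewrite -[z]osp_act1 -(mulVg g) osp_actM def_z.
by move=> /IHp{}IHp /IHp[B sB ->]; exists B; rewrite // (subset_trans sB) ?subsetDl.
Qed.

(** Rearranging the letters by block index, then by value, turns the blocks into consecutive
    intervals. *)
Lemma osp_cutP x : exists A g, x = osp_act (osp0 A) g.
Proof.
have [f [ltf ontof] def_x] := osp_levels x.
have inj_key : injective (fun e : 'I_m => f e * m + e).
  move=> a b /(congr1 (modn^~ m)); rewrite !modnMDl !modn_small //.
  exact: val_inj.
have [p pkey] := rank_perm inj_key.
(* The block index at sorted position e; [inord] is only relied upon below m. This function is
   monotone, starts at 0 and skips no value, so the cuts are where it jumps. *)
pose h (e : nat) := f ((p^-1)%g (inord e)).
have h_le e e' : e <= e' -> e' < m -> h e <= h e'.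
  move=> le lt'; have lt := leq_ltn_trans le lt'.
  rewrite leqNgt; apply/negP => lth; move: le; rewrite leqNgt => /negP[].
  suff : p ((p^-1)%g (inord e')) < p ((p^-1)%g (inord e)) by rewrite !permKV !inordK.
  rewrite pkey; move: lth; rewrite /h; set u := (_ (inord e')); set v := (_ (inord e)).
  by have := ltn_ord u; nia.
have onto_h k : k < size x -> exists2 e, e < m & h e = k.
  by case/ontof=> e <-; exists (p e) => //; rewrite /h inord_val permK.
have x_gt0 : 0 < size x by apply: leq_ltn_trans (ltf ord0).
have h0 : h 0 = 0.
  by have [e lte he] := onto_h 0 x_gt0; have := h_le 0 e (leq0n e) lte; rewrite he; case: (h 0).
have hS e : e.+1 < m -> h e.+1 = h e + (h e < h e.+1).
  move=> lte; have [lth|geh] := ltnP (h e) (h e.+1); last first.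
    by rewrite addn0; apply/eqP; rewrite eqn_leq geh h_le.
  apply/eqP; rewrite addn1 eqn_leq lth andbT leqNgt; apply/negP => lth'.
  have [e' lte' he'] := onto_h (h e).+1 (ltn_trans lth' (ltf _)).
  have [lee'|lee'] := leqP e' e.
    by have := h_le _ _ lee' (ltnW lte); rewrite he' ltnn.
  by have := h_le _ _ lee' lte'; rewrite he' leqNgt lth'.
pose A := [set a : 'I_n | h a < h a.+1].
have levelA e : e < m -> level A e = h e.
  elim: e => [|e IHe] lte; first by rewrite level0 h0.
  by rewrite hS // (levelS A (Ordinal (lte : e < n))) inE IHe // ltnW.
have cardA : #|A|.+1 = size x.
  rewrite -(level_max A (leqnn n)) levelA //; apply/eqP; rewrite eqn_leq ltf.
  have [e lte he] := onto_h (size x).-1 ltac:(by rewrite prednK).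
  by rewrite -(prednK x_gt0) ltnS -he h_le.
exists A, (p^-1)%g; have <- : osp_act x p = osp0 A; last first.
  by rewrite -osp_actM mulgV osp_act1.
apply: osp_inj; rewrite (osp_act_levels p def_x) osp0E cardA.
apply: eq_map => k; apply/setP => e; rewrite !inE.
by rewrite levelA // /h inord_val.
Qed.

Lemma down_closed_card (D : {set 'I_m}) :
    (forall e e' : 'I_m, e <= e' -> e' \in D -> e \in D) ->
  forall e : 'I_m, (e \in D) = (e < #|D|).
Proof.
move=> downD e; have [De|nDe] := boolP (e \in D); apply/esym; last first.
  apply/negbTE; rewrite -leqNgt -[leqRHS](card_ord_ltn (ltnW (ltn_ord e))).
  apply/subset_leq_card/subsetP => c Dc; rewrite inE ltnNge.
  by apply: contra nDe => /downD->.
rewrite -[X in X <= _](card_ord_ltn (ltn_ord e)); apply/subset_leq_card/subsetP => c.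
by rewrite inE ltnS => /downD->.
Qed.

(** The action preserves the sequence of block sizes, and the partial sums of the sizes recover the
    cuts. *)
Lemma osp0_act_inj A B g h : osp_act (osp0 A) g = osp_act (osp0 B) h -> A = B.
Proof.
have card_level C k : #|[set e : 'I_m | level C e < k]|
    = \sum_(l < k) #|[set e : 'I_m | level C e == l]|.
  elim: k => [|k IHk]; first by rewrite big_ord0; apply: eq_card0 => e; rewrite inE.
  rewrite big_ord_recr -IHk /= -(cardsID [set e : 'I_m | level C e < k]).
  by congr (_ + _); apply: eq_card => e; rewrite !inE; lia.
have mem_cut (C : {set 'I_n}) (a : 'I_n) :
    a \in C -> #|[set e : 'I_m | level C e < (level C a).+1]| = a.+1.
  move=> Ca; rewrite -[RHS](@card_ord_ltn m) ?ltnS 1?ltnW //.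
  by apply: eq_card => e; rewrite !inE !ltnS leqNgt level_lt // -leqNgt.
have sub (C D : {set 'I_n}) u v : osp_act (osp0 C) u = osp_act (osp0 D) v -> C \subset D.
  move=> eqCD; have eqs : [seq #|X| | X : {set 'I_m} <- osp0 C]
      = [seq #|X| | X : {set 'I_m} <- osp0 D].
    have card_act x g' : [seq #|X| | X : {set 'I_m} <- osp_act x g']
        = [seq #|X| | X : {set 'I_m} <- x].
      by rewrite -map_comp; apply: eq_map => X /=; rewrite card_imset //; apply: perm_inj.
    by rewrite -(card_act _ u) eqCD card_act.
  have card_eq l : #|[set e : 'I_m | level C e == l]| = #|[set e : 'I_m | level D e == l]|.
    have eq_size : #|C| = #|D|.
      by have := congr1 size eqs; rewrite !size_map !size_iota => -[].
    have [lel|ltl] := leqP l #|C|; last first.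
      by rewrite !eq_card0 // => e; rewrite inE; apply/negbTE;
         rewrite neq_ltn (leq_ltn_trans (level_le_card _ _)) -?eq_size.
    have := congr1 (fun s => nth 0 s l) eqs.
    by rewrite !(nth_map set0) ?size_map ?size_iota -?eq_size // !nth_mkseq -?eq_size.
  apply/subsetP => a Ca; have := mem_cut C a Ca.
  rewrite card_level; under eq_bigr do rewrite card_eq; rewrite -card_level.
  (* This initial segment for the levels of D has as many letters as the one of C ending at the cut
     a, so it also ends at a, and D must jump there. *)
  set E := [set e : 'I_m | _] => cE.
  have memE := @down_closed_card E _; rewrite cE in memE.
  have {}memE : forall e : 'I_m, (level D e < (level C a).+1) = (e < a.+1).
    move=> e; rewrite -memE ?inE // => c c' le; rewrite !inE.
    by apply: leq_ltn_trans; rewrite level_le.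
  have := memE (widen_ord (leqnSn n) a); rewrite /= ltnSn => le1.
  have lta : a.+1 < m by rewrite ltnS.
  have := memE (Ordinal lta); rewrite /= ltnn levelS; case: (a \in D) => //.
  by rewrite addn0 le1.
by move=> eqAB; apply/eqP; rewrite eqEsubset (sub _ _ _ _ eqAB) (sub _ _ _ _ (esym eqAB)).
Qed.

(** A complete invariant of the orbit of x: exactly one A qualifies by [osp_cutP] and
    [osp0_act_inj], so the default is never reached. *)
Definition cuts x : {set 'I_n} :=
  odflt set0 [pick A | [exists g, x == osp_act (osp0 A) g]].

Lemma cuts_act A g : cuts (osp_act (osp0 A) g) = A.
Proof.
rewrite /cuts; case: pickP => [B /existsP[h /eqP/osp0_act_inj->] //|/(_ A)/existsP[]].
by exists g.
Qed.

Lemma cutsP x : exists g, x = osp_act (osp0 (cuts x)) g.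
Proof. by have [A [g ->]] := osp_cutP x; exists g; rewrite cuts_act. Qed.

Lemma cuts_osp_act x g : cuts (osp_act x g) = cuts x.
Proof. by have [h {1}->] := cutsP x; rewrite -osp_actM cuts_act. Qed.

Lemma cuts_le x y : osp_le x y -> cuts y \subset cuts x.
Proof.
have [g {1}->] := cutsP x; case/osp0_act_le=> B sB ->.
by rewrite cuts_act.
Qed.

Lemma cuts_le_inj x y : osp_le x y -> cuts x = cuts y -> x = y.
Proof.
have [g defx] := cutsP x; rewrite {1}defx; case/osp0_act_le=> B sB ->.
by rewrite cuts_act => <-.
Qed.

End Cuts.

(** * Coranks and orbits of chains *)

Section RankFunction.

Context {d : Order.disp_t} {P : finPOrderType d}.
Implicit Types (x y : P) (C : {set P}).

Lemma rk_lt x y : (y < x)%O -> rk y < rk x.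
Proof.
move=> ltyx; pose p (C : {set P}) := is_chain C && [forall z in C, (z < y)%O].
have p0 : 0 < #|p|.
  apply/card_gt0P; exists set0; rewrite unfold_in; apply/andP; split;
    by apply/forall_inP => z; rewrite inE.
have [C /andP[/forall_inP Cch /forall_inP Cy] rk_y] :=
  eq_bigmax_cond (fun C : {set P} => #|C|) p0.
have yC : y \notin C by apply/negP => /Cy; rewrite ltxx.
have -> : rk y = #|C| by [].
apply: leq_trans (_ : #|y |: C| <= _); first by rewrite cardsU1 yC.
apply: (leq_bigmax_cond (F := fun C : {set P} => #|C|)); apply/andP; split.
  apply/forall_inP => u /setU1P[->|Cu]; apply/forall_inP => v /setU1P[->|Cv].
  - exact: comparablexx.
  - by rewrite /Order.comparable (ltW (Cy v Cv)) orbT.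
  - by rewrite /Order.comparable (ltW (Cy u Cu)).
  - exact: (forall_inP (Cch u Cu)).
apply/forall_inP => u /setU1P[->//|/Cy/lt_trans]; exact.
Qed.

Lemma rk_le (f : P -> nat) x : {homo f : u v / (u < v)%O >-> u < v} -> rk x <= f x.
Proof.
move=> mono_f; apply/bigmax_leqP => C /andP[/forall_inP Cch /forall_inP Cx].
have inj_f : {in C &, injective f}.
  move=> u v Cu Cv eqf; have := forall_inP (Cch u Cu) v Cv.
  by case: comparableP => // /mono_f; rewrite eqf ltnn.
rewrite cardE -(size_map f) -[leqRHS](size_iota 0); apply: uniq_leq_size.
  rewrite map_inj_in_uniq ?enum_uniq // => u v; rewrite !mem_enum; exact: inj_f.
by move=> _ /mapP[u Cu ->]; rewrite mem_iota /= mono_f // Cx // -mem_enum.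
Qed.

End RankFunction.

(** * Corank as number of cuts, and orbits of chains *)

Section Corank.

Variable n : nat.
Local Notation m := n.+1.
Implicit Types (x y : Omega m) (A B : {set 'I_n}) (g : 'S_m) (C : {set Omega m}).

Definition ocuts x : {set 'I_n} := if x is Some u then cuts u else set0.

Lemma ocuts_lt (u : osp m) y : ((Some u : Omega m) < y)%O -> ocuts y \proper cuts u.
Proof.
case: y => [v|]; rewrite lt_neqAle => /andP[ne le] //=.
rewrite properEneq cuts_le // andbT; apply: contra ne => /eqP eqc.
by rewrite (cuts_le_inj le (esym eqc)).
Qed.

(** The right side, extended by 0 at the minimum, is strictly increasing and so bounds the rank from
    above. Adding missing cuts one at a time descends far enough for the converse. *)
Lemma rk_osp (u : osp m) : rk (Some u : Omega m) = m - #|cuts u|.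
Proof.
apply/eqP; rewrite eqn_leq; apply/andP; split.
  apply: (@rk_le _ (Omega m) (fun x => if x is Some v then m - #|cuts v| else 0)).
  move=> [v|] [w|] //= lt; last by rewrite subn_gt0 ltnS -[leqRHS]card_ord max_card.
  apply: ltn_sub2l; last exact: proper_card (@ocuts_lt v (Some w) lt).
  by rewrite ltnS (leq_trans (max_card _)) // card_ord.
have [k] := ubnP (m - #|cuts u|); elim: k u => // k IHk u; rewrite ltnS => lek.
have [g def_u] := cutsP u.
have [allcut|/subsetPn[a _ na]] := boolP ([set: 'I_n] \subset cuts u).
  have -> : cuts u = setT by apply/eqP; rewrite eqEsubset subsetT.
  rewrite cardsT card_ord subSnn.
  have /rk_lt : ((None : Omega m) < Some u)%O by rewrite lt_neqAle.
  exact: leq_ltn_trans.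
pose v := osp_act (osp0 (a |: cuts u)) g.
have ltvu : ((Some v : Omega m) < Some u)%O.
  rewrite lt_neqAle; apply/andP; split.
    apply/eqP => -[/(congr1 (@cuts n))]; rewrite cuts_act => /setP/(_ a).
    by rewrite setU11 (negPf na).
  by rewrite def_u; apply/osp_act_le/osp0_le/subsetUr.
have cv : #|cuts v| = #|cuts u|.+1 by rewrite cuts_act cardsU1 na.
have leu : #|cuts u| < m by rewrite ltnS (leq_trans (max_card _)) // card_ord.
apply: leq_trans (rk_lt ltvu); rewrite -(subnSK leu) ltnS -cv; apply: IHk.
by rewrite cv; apply: leq_trans lek; rewrite -(subnSK leu).
Qed.

Lemma crk_osp (u : osp m) : crk (Some u : Omega m) = #|cuts u|.
Proof. by rewrite /crk rk_osp subKn // (leq_trans (max_card _)) // card_ord. Qed.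

Variable T : {fset nat}.
Hypothesis leT : forall j, j \in T -> 0 < j <= n.
Local Notation Q := (Omega_sel_proper m T).

(** Deleting the top costs no element of corank in [T]: it has no cuts, and 0 is not in [T]. *)
Lemma mem_sel x : (x \in Q) = (if x is Some u then #|cuts u| \in T else false).
Proof.
case: x => [u|]; last by rewrite !inE eqxx.
have cuts_top : cuts (osp_top m) = set0.
  apply/eqP; rewrite -subset0 -(cuts_act set0 1%g).
  exact/cuts_le/osp_le_top.
have top_eq : ((Some u : Omega m) == \top%O) = (u == osp_top m) by [].
rewrite !inE top_eq /= crk_osp.
have [->|_] := eqVneq u (osp_top m); last by rewrite orbF.
by rewrite cuts_top cards0; apply/esym/negbTE/negP => /leT.
Qed.

Definition shadow C : {set {set 'I_n}} := ocuts @: C.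

Lemma shadow_inj C : C \subset Q -> is_chain C -> {in C &, injective ocuts}.
Proof.
move=> /subsetP sCQ /forall_inP Cch x y Cx Cy.
have := sCQ x Cx; have := sCQ y Cy; have := forall_inP (Cch x Cx) y Cy.
rewrite !mem_sel; case: x y {Cx Cy} => [u|] [v|] //= /orP[] le _ _ eqc.
  by rewrite (cuts_le_inj le eqc).
by rewrite (cuts_le_inj le (esym eqc)).
Qed.

Lemma card_shadow C : C \subset Q -> is_chain C -> #|shadow C| = #|C|.
Proof. by move=> sCQ Cch; apply/card_in_imset/shadow_inj. Qed.

Lemma shadow_tchain C : C \subset Q -> is_chain C -> tchain T (shadow C).
Proof.
move=> /subsetP sCQ /forall_inP Cch; apply/andP; split; last first.
  by apply/forall_inP => _ /imsetP[x /sCQ Cx ->]; move: Cx; rewrite mem_sel; case: x.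
apply/nestedP => _ _ /imsetP[x Cx ->] /imsetP[y Cy ->].
have := sCQ x Cx; have := sCQ y Cy; have := forall_inP (Cch x Cx) y Cy.
rewrite !mem_sel; case: x y {Cx Cy} => [u|] [v|] //= /orP[] /cuts_le-> //.
by rewrite orbT.
Qed.

(** Everything in the chain coarsens its least element, the one with most cuts. A permutation
    carrying the interval representative to that element does the same for all its coarsenings. *)
Lemma chain_translate C : C \subset Q -> is_chain C ->
  exists g, C = [set (Some (osp_act (osp0 A) g) : Omega m) | A in shadow C].
Proof.
move=> sCQ Cch; have [->|[x1 Cx1]] := set_0Vmem C.
  by exists 1%g; rewrite /shadow !imset0.
case: (@arg_maxnP _ x1 (mem C) (fun x => #|ocuts x|)) => // x0 /= Cx0 max_x0.
have le_x0 x : x \in C -> (x0 <= x)%O.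
  move=> Cx; have /orP[//|le] := forall_inP (forall_inP Cch x0 Cx0) x Cx.
  suff -> : x = x0 by exact: lexx.
  apply: (shadow_inj sCQ Cch) => //; apply/esym/eqP; rewrite eqEcard max_x0 // andbT.
  have := subsetP sCQ x Cx; have := subsetP sCQ x0 Cx0; rewrite !mem_sel.
  by case: x x0 le {max_x0 Cx0 Cx} => [u|] [v|] // /cuts_le.
have := subsetP sCQ x0 Cx0; rewrite mem_sel; case: x0 Cx0 max_x0 le_x0 => // u0 Cx0 _ le_x0 _.
have [g def_u0] := cutsP u0.
have defC x : x \in C -> x = Some (osp_act (osp0 (ocuts x)) g).
  move=> Cx; have := le_x0 x Cx; have := subsetP sCQ x Cx.
  rewrite mem_sel; case: x {Cx} => // u _; rewrite def_u0.
  by case/osp0_act_le=> B _ ->; rewrite /= cuts_act.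
exists g; apply/setP => x; apply/idP/imsetP => [Cx|[_ /imsetP[y Cy ->] ->]].
  by exists (ocuts x); [apply: imset_f | apply: defC].
by rewrite -defC.
Qed.

Lemma shadow_act C g : shadow ((Omega_action m)^*%act C g) = shadow C.
Proof.
rewrite /shadow -imset_comp; apply: eq_imset => -[u|] //=.
exact: cuts_osp_act.
Qed.

Lemma shadow_orbit C C' :
    C \subset Q -> is_chain C -> C' \subset Q -> is_chain C' ->
  shadow C = shadow C' -> exists g, C' = (Omega_action m)^*%act C g.
Proof.
move=> sCQ Cch sCQ' Cch' eqs.
have [g defC] := chain_translate sCQ Cch.
have [h defC'] := chain_translate sCQ' Cch'.
exists (g^-1 * h)%g; move: defC defC'; rewrite -eqs.
move: (shadow C) => G -> ->; rewrite /= /setact -imset_comp.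
apply: eq_imset => A /=.
by rewrite -osp_actM mulgA mulgV mul1g.
Qed.

Lemma tchain_shadow G : tchain T G ->
  exists C, [/\ C \subset Q, is_chain C & shadow C = G].
Proof.
move=> cG; have cuts0 A : cuts (osp0 A) = A by rewrite -[osp0 A]osp_act1 cuts_act.
exists [set (Some (osp0 A) : Omega m) | A in G]; split.
- apply/subsetP => _ /imsetP[A GA ->].
  by rewrite mem_sel cuts0 (tchain_mem cG).
- apply/forall_inP => _ /imsetP[A GA ->]; apply/forall_inP => _ /imsetP[B GB ->].
  have /orP[sAB|sBA] := nestedP _ (tchain_nested cG) A B GA GB.
    by apply/orP; right; apply: osp0_le.
  by apply/orP; left; apply: osp0_le.
- rewrite /shadow -imset_comp -[RHS]imset_id.
  by apply: eq_imset => A /=; rewrite cuts0.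
Qed.

Lemma max_face_card_sel : max_face_card Q = #|` T|.
Proof.
apply/eqP; rewrite eqn_leq; apply/andP; split.
  apply/bigmax_leqP => C /andP[sCQ Cch].
  by rewrite -(card_shadow sCQ Cch) (tchain_card (shadow_tchain sCQ Cch)).
have leT' t : t \in T -> t <= n by case/leT/andP.
have /flagsP[cF <-] := flag_flags 1%g leT'.
have [C [sCQ Cch <-]] := tchain_shadow cF.
rewrite card_shadow //; apply: (leq_bigmax_cond (F := fun C : {set Omega m} => #|C|)).
by rewrite sCQ.
Qed.

End Corank.

(** * Invariants of the chain complex *)

Section InvariantChains.

Local Open Scope ring_scope.

Variables (n : nat) (T : {fset nat}).
Hypothesis leT : forall j, j \in T -> (0 < j <= n)%N.
Local Notation m := n.+1.
Local Notation Q := (Omega_sel_proper m T).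
Local Notation rC k :=
  (chain_repr (@Omega_act_mono m) (@Omega_sel_proper_stable m T) k).
Local Notation fshadow i := (shadow (face i)).

Lemma faceP k (i : 'I_#|faces Q k|) :
  [/\ face i \subset Q, is_chain (face i) & #|face i| = k].
Proof. by have := enum_valP i; rewrite inE => /and3P[? ? /eqP]. Qed.

Lemma face_ex k (C : {set Omega m}) : C \subset Q -> is_chain C -> #|C| = k ->
  exists i : 'I_#|faces Q k|, face i = C.
Proof.
move=> sCQ Cch cC; have FC : C \in faces Q k by rewrite inE sCQ Cch cC eqxx.
by exists (enum_rank_in FC C); rewrite /face enum_rankK_in.
Qed.

Lemma fshadow_tchain k (i : 'I_#|faces Q k|) : tchain T (fshadow i).
Proof. by have [sFQ Fch _] := faceP i; apply: shadow_tchain. Qed.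

Lemma card_fshadow k (i : 'I_#|faces Q k|) : #|fshadow i| = k.
Proof. by have [sFQ Fch cF] := faceP i; rewrite (card_shadow leT). Qed.

Lemma fshadow_ex k (G : {set {set 'I_n}}) : tchain T G -> #|G| = k ->
  exists i : 'I_#|faces Q k|, fshadow i = G.
Proof.
move=> cG cardG; have [C [sCQ Cch sC]] := tchain_shadow leT cG.
have [|i defC] := face_ex sCQ Cch (k := k); first by rewrite -(card_shadow leT sCQ Cch) sC.
by exists i; rewrite defC.
Qed.

(** Left multiplication by the action leaves the average unchanged, so each column is constant on
    orbits. Entries between distinct orbits vanish, and the identity makes the diagonal positive. *)
Lemma avg_chain_mx k : exists2 c : 'I_#|faces Q k| -> rat,
    (forall j, c j != 0)
  & forall i j, avg_mx (rC k) i j = c j *+ (fshadow i == fshadow j).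
Proof.
exists (fun j => avg_mx (rC k) j j) => [j|i j].
  rewrite !mxE summxE mulf_neq0 ?invr_eq0 ?natrG_neq0 // gt_eqF //.
  rewrite (bigD1 1%g) ?inE //= mxE act1 eqxx ltr_wpDr ?ltr01 //.
  by apply: sumr_ge0 => g _; rewrite mxE ler0n.
case: eqP => [eqs|nes]; last first.
  rewrite !mxE summxE big1 ?mulr0 // => g _; rewrite mxE.
  by case: eqP => // eqf; case: nes; rewrite eqf shadow_act.
have [sFi Fi _] := faceP i; have [sFj Fj _] := faceP j.
have [g def_j] := shadow_orbit leT sFi Fi sFj Fj eqs.
rewrite mulr1n -(chain_mx_mul (avg_mx (rC k)) j def_j).
by rewrite -[in LHS](mul_repr_avg (rC k) (in_setT g)).
Qed.

(* Only the vertex of i whose cut set is missing from the shadow of j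
   contributes, and its position depends on j alone. *)
Lemma boundary_shadow k (j : 'I_#|faces Q k|) : k.+1 = #|` T| ->
  exists2 e : rat, e != 0 & forall i : 'I_#|faces Q k.+1|,
      \sum_(j' | fshadow j' == fshadow j) boundary Q k.+1 i j'
      = e *+ (fshadow j \subset fshadow i).
Proof.
move=> cT; have [S sST [cS memS]] := tchain_sizes (fshadow_tchain j).
have /fsubsetPn[t Tt nSt] : ~~ (T `<=` S)%fset.
  apply/negP => /fsubset_leq_card.
  by rewrite cS card_fshadow -cT ltnn.
exists ((-1) ^+ #|[set A in fshadow j | (t < #|A|)%N]|) => [|i].
  by rewrite expf_neq0 // oppr_eq0 oner_eq0.
have [sFi Fi cFi] := faceP i; have injF := shadow_inj leT sFi Fi.
have flagi : fshadow i \in flags n T.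
  by apply/flagsP; rewrite card_fshadow fshadow_tchain.
(* After exchanging the sums, each deleted vertex x determines a single face, which counts when its
   shadow is that of j. *)
transitivity (\sum_(x in face i | shadow (face i :\ x) == fshadow j)
    (-1) ^+ #|[set y in face i | (y < x)%O]| : rat).
  under eq_bigr do rewrite mxE big_mkcondr /=.
  rewrite exchange_big [RHS]big_mkcondr /=; apply: eq_bigr => x Fx.
  have sD : face i :\ x \subset face i by apply: subsetDl.
  have [|||j0 def_j0] := @face_ex k (face i :\ x).
  - exact: subset_trans sFi.
  - apply/forall_inP => u /(subsetP sD) Fu; apply/forall_inP => v /(subsetP sD) Fv.
    exact: (forall_inP (forall_inP Fi u Fu)).
  - by move: cFi; rewrite (cardsD1 x) Fx => -[].
  rewrite -def_j0 -big_mkcondr /=.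
  case: ifP => [eqs|nes].
    rewrite (big_pred1 j0) // => j1 /=; rewrite (inj_eq (@face_inj _ _ _ _)).
    by case: (j1 =P j0) => [->|_]; rewrite ?eqs ?andbF.
  rewrite big_pred0 // => j1; apply/negbTE/negP => /andP[eqs /eqP/face_inj eqj].
  by rewrite -eqj eqs in nes.
have shadowD x : x \in face i -> shadow (face i :\ x) = fshadow i :\ ocuts x.
  move=> Fx; apply/setP => A; apply/imsetP/setD1P => [[y /setD1P[ne Fy] ->]|[ne /imsetP[y Fy eqA]]].
    by split; [rewrite (inj_in_eq injF) | apply: imset_f].
  by exists y; rewrite // !inE Fy andbT; apply: contraNneq ne => <-; rewrite eqA.
have [sub|nsub] := boolP (fshadow j \subset fshadow i); last first.
  rewrite mulr0n big_pred0 // => x; apply/negbTE/negP => /andP[Fx /eqP eqs].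
  by rewrite -eqs shadowD // subsetDl in nsub.
have cD : #|fshadow i :\: fshadow j| = 1%N.
  by apply/eqP; rewrite -(eqn_add2l #|fshadow j|) -{1}(setIidPr sub) cardsID !card_fshadow addn1.
have /cards1P[A defA] := introT eqP cD.
have /setDP[/imsetP[x Fx eqA] nAj] : A \in fshadow i :\: fshadow j by rewrite defA set11.
have defj : fshadow j = fshadow i :\ A.
  by rewrite -defA setDDr setDv set0U (setIidPr sub).
rewrite (big_pred1 x) => [|y]; last first.
  apply/andP/eqP => [[Fy]|->]; last by rewrite Fx shadowD // -eqA -defj eqxx.
  rewrite shadowD // defj => /eqP/setP/(_ A); rewrite !inE eqxx /=.
  rewrite {2}eqA imset_f // andbT => /negbFE/eqP eqAy.
  by apply: injF; rewrite // -eqAy.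
(* The shadow of i has a member of every size in [T], while that of j has none of size t. *)
have eqt : #|A| = t.
  have [B iB cB] := flags_mem flagi Tt; have : B \in fshadow i :\: fshadow j.
    by rewrite inE iB andbT; apply: contra nSt => jB; apply/memS; exists B.
  by rewrite defA => /set1P <-.
rewrite mulr1n; congr (_ ^+ _).
(* Lower elements have more cuts, so the sign exponent counts the members of the shadow of j of size
   above t, whatever i is. *)
have cuts_lt y : y \in face i -> (y < x)%O = (#|ocuts x| < #|ocuts y|)%N.
  have := subsetP sFi x Fx; move: (Fx); rewrite (mem_sel leT).
  case: {+}x => // u Fu _ Fy; have := subsetP sFi y Fy.
  rewrite (mem_sel leT); case: {+}y Fy => // v Fv _.
  apply/idP/idP => [/ocuts_lt/proper_card//|ltc].
  have /orP[le|le] := forall_inP (forall_inP Fi _ Fu) _ Fv; last first.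
    by rewrite lt_neqAle le andbT; apply: contraTneq ltc => ->; rewrite ltnn.
  by have := subset_leq_card (cuts_le le); rewrite leqNgt ltc.
rewrite -(card_in_imset (f := @ocuts n)) => [|y z]; last first.
  by rewrite !inE => /andP[Fy _] /andP[Fz _]; apply: injF.
apply: eq_card => B; rewrite inE -eqt eqA defj eqA.
apply/imsetP/andP => [[y]|[/setD1P[_ /imsetP[y Fy ->]] lt]].
  rewrite inE => /andP[Fy]; rewrite cuts_lt // => lt ->; split=> //.
  by rewrite !inE imset_f // andbT; apply: contraTneq lt => ->; rewrite ltnn.
by exists y; rewrite // inE Fy cuts_lt.
Qed.


End InvariantChains.

(** * The multiplicity as a difference of ranks *)

Section TrivialMultiplicity.

Local Open Scope ring_scope.

Variables (n : nat) (T : {fset nat}).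
Hypothesis leT : forall j, j \in T -> (0 < j <= n)%N.
Local Notation m := n.+1.
Local Notation Q := (Omega_sel_proper m T).
Local Notation r := #|` T|.
Local Notation rC k :=
  (chain_repr (@Omega_act_mono m) (@Omega_sel_proper_stable m T) k).
Local Notation fshadow i := (shadow (face i)).

(** Transposed, X has as rows nonzero multiples of the indicators [above], pulled back from flags to
    faces along the shadow. Every flag is a shadow, so the pullback is injective and preserves
    rank. *)
Lemma rank_pullback q k (X : 'M[rat]_(#|faces Q q|, #|faces Q k|)) (c : _ -> rat) :
    q = r -> (forall j, c j != 0) ->
    (forall i j, X i j = c j *+ (fshadow j \subset fshadow i)) ->
  \rank X = \rank (\sum_(G : {set {set 'I_n}} | tchain T G && (#|G| == k)) <<above T G>>)%MS.
Proof.
move=> eq_q nz_c XE.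
pose E := \matrix_(j < #|faces Q k|) (c j *: above T (fshadow j)).
pose Pi : 'M[rat]_(#|flags n T|, #|faces Q q|) :=
  \matrix_(a, i) ((enum_val a : {set {set 'I_n}}) == fshadow i)%:R.
have flagF (i : 'I_#|faces Q q|) : fshadow i \in flags n T.
  by apply/flagsP; split; [apply: fshadow_tchain | rewrite (card_fshadow leT)].
have rankF (i : 'I_#|faces Q q|) : {a : 'I_#|flags n T| | enum_val a = fshadow i}.
  by exists (enum_rank_in (flagF i) (fshadow i)); apply: enum_rankK_in (flagF i).
have defX : X^T = E *m Pi.
  apply/matrixP => j i; rewrite !mxE XE; have [a def_a] := rankF i.
  rewrite (bigD1 a) //= big1 => [|b ne_ba]; last first.
    by rewrite !mxE -def_a (inj_eq enum_val_inj) (negPf ne_ba) mulr0.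
  by rewrite !mxE def_a eqxx mulr1 addr0 mulr_natr.
have faceF (a : 'I_#|flags n T|) : exists i : 'I_#|faces Q q|, fshadow i = enum_val a.
  by have /flagsP[ca cardA] := enum_valP a; apply: (fshadow_ex leT); rewrite // eq_q.
have [sec secP] := fin_all_exists faceF.
have freePi : row_free Pi.
  apply/row_freeP; exists (\matrix_(i, a) (i == sec a)%:R).
  apply/matrixP => a b; rewrite !mxE (bigD1 (sec b)) //= big1 => [|i ne]; last first.
    by rewrite !mxE (negPf ne) mulr0.
  by rewrite !mxE eqxx mulr1 addr0 secP (inj_eq enum_val_inj).
rewrite -mxrank_tr defX mxrankMfree //; apply/eqmx_rank/andP; split.
  apply/row_subP => j; rewrite rowK scalemx_sub // -(genmxE (above _ _)).
  apply: (sumsmx_sup (fshadow j)) => //.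
  by rewrite (fshadow_tchain leT) (card_fshadow leT) eqxx.
apply/sumsmx_subP => G /andP[cG /eqP cardG]; rewrite genmxE.
have [j <-] := fshadow_ex leT cG cardG.
rewrite -[above _ _]scale1r -(mulVf (nz_c j)) -scalerA scalemx_sub //.
by rewrite -(rowK (fun j => c j *: above T (fshadow j))) row_sub.
Qed.

Lemma rank_avg_chain : \rank (avg_mx (rC r)) = #|flags n T|.
Proof.
have [c nz_c avgE] := avg_chain_mx leT r.
rewrite (rank_pullback (erefl r) nz_c) => [|i j]; last first.
  by rewrite avgE eq_sym eqEcard !(card_fshadow leT) leqnn andbT.
apply/eqP; rewrite -[_ == _]/(row_full _) -sub1mx; apply/row_subP => a.
have [ca cardA] := flagsP _ _ (enum_valP a).
rewrite row1 -above_flag -(genmxE (above _ _)).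
by apply: (sumsmx_sup (enum_val a)); rewrite // ca cardA eqxx.
Qed.

(** The average is moved past the boundary by equivariance; [boundary_shadow] then evaluates each
    entry as a sum over faces with one shadow. For empty [T] both sides vanish. *)
Lemma rank_avg_boundary q : q = r ->
  \rank (avg_mx (rC q) *m boundary Q q) = \rank (facets n T).
Proof.
have -> : avg_mx (rC q) *m boundary Q q = boundary Q q *m avg_mx (rC q.-1).
  rewrite -scalemxAl -scalemxAr mulmx_suml mulmx_sumr; congr (_ *: _).
  apply: eq_bigr => g _.
  exact: (boundary_equivariant (@Omega_act_mono m) (@Omega_sel_proper_stable m T)).
case: q => [|k] def_r.
  rewrite /facets -def_r big_pred0 => [|G]; last by rewrite andbF.
  rewrite mxrank0; apply/eqP; rewrite mxrank_eq0 (_ : boundary Q 0 = 0) ?mul0mx //.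
  apply/matrixP => i j; rewrite !mxE big_pred0 // => x.
  have [_ _ /eqP] := faceP i; rewrite cards_eq0 => /eqP->.
  by rewrite inE.
have [c nz_c avgE] := avg_chain_mx leT k.
have [e nz_e eE] := fin_all_exists2 (fun j => boundary_shadow leT j def_r).
rewrite (rank_pullback (c := fun j => c j * e j) def_r) => [|j|i j].
- by apply: congr1; apply: eq_bigl => G; rewrite -def_r eqSS.
- by rewrite mulf_neq0.
rewrite -mulrnAr -eE mulr_sumr mxE [RHS]big_mkcond /=.
apply: eq_bigr => j' _; rewrite avgE; case: ifP => _; first by rewrite mulr1n mulrC.
by rewrite mulr0n mulr0.
Qed.

(** No boundaries enter top degree, so the multiplicity is the rank of the averaged cycles: the
    number of flags minus the rank of [facets]. *)
Lemma trivial_mult_top_Des :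
  trivial_mult_top m T = #|[set s : 'S_n | Des s == T]|%:R.
Proof.
rewrite /trivial_mult_top /top_homology_repr (max_face_card_sel leT).
rewrite trivial_multE; congr _%:R.
have modB := boundaries_module (@Omega_act_mono m) (@Omega_sel_proper_stable m T) r.
have modZ := cycles_module (@Omega_act_mono m) (@Omega_sel_proper_stable m T) r.
rewrite /homology_repr (bool_irrelevance (boundaries_module _ _ _) modB).
rewrite (bool_irrelevance (cycles_module _ _ _) modZ).
have := rank_avg_section modB modZ.
(* The matrix has no rows: a face with r + 1 elements would have a shadow with more sizes than
   [T]. *)
have B0 : boundary Q r.+1 = 0.
  apply/matrixP => i.
  by have := tchain_card (fshadow_tchain leT i); rewrite (card_fshadow leT) ltnn.
have rank0 : \rank <<boundary Q r.+1>>%MS = 0%N by rewrite genmxE B0 mxrank0.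
have /eqP := rank0; rewrite mxrank_eq0 => /eqP gen0.
rewrite rank0 addn0 => ->; rewrite gen0 adds0mx.
have /(_ (mxmodule_avg modZ)) := rank_ker_idem (B := boundary Q r) (avg_mx_id (rC r)).
rewrite (rank_avg_boundary (erefl r)) rank_avg_chain.
have leT' t : t \in T -> (t <= n)%N by case/leT/andP.
by move=> rk_eq; apply: addnI (etrans rk_eq (rank_facets leT')).
Qed.

End TrivialMultiplicity.

Theorem mainTheorem12 (m : nat) (T : {fset nat}) (hm : 1 <= m)
    (hT : forall j : nat, j \in T -> 1 <= j <= m.-1) :
  (m.-1 \notin T ->
     trivial_mult_top m T = (#|[set s : 'S_(m.-1) | Des s == T]|%:R)%R
     /\ (1 <= trivial_mult_top m T)%R)
  /\ (m.-1 \in T -> trivial_mult_top m T = 0%R).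
Proof.
case: m hm hT => // n _ /= hT; rewrite (trivial_mult_top_Des hT).
split=> [nTn | Tn].
  split=> //; rewrite ler1n card_gt0; apply/set0Pn.
  (* With n outside [T], every element of [T] is a possible descent position, so the count is
     positive. *)
  have [|s sT] := @Des_surj n T; last by exists s; rewrite inE sT.
  move=> t Tt; have /andP[-> /=] := hT t Tt; rewrite leq_eqVlt => /predU1P[eqtn|//].
  by rewrite -eqtn Tt in nTn.
apply/eqP; rewrite pnatr_eq0 cards_eq0; apply/eqP/setP => s; rewrite !inE.
(* A descent at n would need a letter in position n + 1. *)
apply/negP => /eqP sT; move: Tn; rewrite -sT => /DesP[_ [i [_ eqi _]]].
by have := ltn_ord i; rewrite eqi ltnn.
Qed.
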